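(* Let $W\subset\mathbb{R}^2\times[0,T)$ be relatively open and let $\theta: W\to\mathbb{R}/2\pi\mathbb{Z}$ be a $C^\infty$ function satisfying on $W$ $$\frac{\partial\theta}{\partial t}=\theta_{11}\cos^2\theta+2\theta_{12}\sin\theta\cos\theta+\theta_{22}\sin^2\theta,$$ where $\theta_{ij}=\frac{\partial^2\theta}{\partial y^i\partial y^j}$ with respect to the standard coordinates $y^1,y^2$ of $\mathbb{R}^2$. Let $V_1$ be the time-dependent vector field $V_1(\cdot,t)=(\cos\theta(\cdot,t),\sin\theta(\cdot,t))$. Then for every $y\in W_0$, where $W_0=\{z\in\mathbb{R}^2:(z,0)\in W\}$, there exist $T_y$ with $0<T_y\le T$ and a family of curves $\{L_t: t\in[0,T_y)\}$ in $\mathbb{R}^2$ such that: (1) each $L_t$ is an integral curve of the vector field $V_1(\cdot,t)$, and $y\in L_0$; (2) the family $\{L_t: t\in[0,T_y)\}$ is smooth in $t$ and is moved by mean curvature flow.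
   Context: $\mathbb{R}^2$ carries the standard Euclidean metric. For each $t$, the vector field $V_1(\cdot,t)$ is defined on the open set $W_t=\{z\in\mathbb{R}^2:(z,t)\in W\}$. Derivatives of an $\mathbb{R}/2\pi\mathbb{Z}$-valued function are those of any local real-valued lift. An integral curve of $V_1(\cdot,t)$ means the image of a map $\gamma$ from an open interval into $W_t$ with $\gamma'(s)=V_1(\gamma(s),t)$. A family of curves $\{L_t\}_{t\in[0,T_y)}$ is smooth in $t$ and moved by mean curvature flow if there are an open interval $I$ and a $C^\infty$ map $F: I\times[0,T_y)\to\mathbb{R}^2$ such that each $F(\cdot,t)$ is an immersion with image $L_t$ and $\frac{\partial F}{\partial t}(x,t)=H(x,t)$, where $H(x,t)$ is the mean curvature (i.e. curvature) vector of the curve $F(\cdot,t)$ at $x$. *)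

(* Defs.v *)
From mathcomp Require Import all_boot all_order all_algebra generic_quotient.
From mathcomp Require Import all_classical all_reals all_analysis.

Set Implicit Arguments.
Unset Strict Implicit.
Unset Printing Implicit Defensive.

Import Order.TTheory GRing.Theory Num.Theory.
Import numFieldNormedType.Exports.

Local Open Scope classical_set_scope.
Local Open Scope ring_scope.

Section Smoothness.
Context {R : realType}.

(* 'D_v1 ('D_v2 (... ('D_vn f))) for vs = [:: v1; ...; vn]. *)
Definition iter_derive {E V : normedModType R} (f : E -> V) (vs : seq E) :
    E -> V :=
  foldr (fun v g => 'D_v g) f vs.

(* C^oo on an open set of a finite-dimensional space: all iterated partial
   derivatives exist and are continuous. *)
Definition smooth_open {E V : normedModType R} (U : set E) (f : E -> V) : Prop :=
  forall (vs : seq E) (p : E), U p ->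
    {for p, continuous (iter_derive f vs)} /\
    (forall v : E, derivable (iter_derive f vs) p v).

(* C^oo on an arbitrary set A, in particular one containing boundary points
   such as those at time 0: near each of its points f|A extends to a C^oo
   function on an open set. The values of f outside A are irrelevant. *)
Definition smooth_on {E V : normedModType R} (A : set E) (f : E -> V) : Prop :=
  forall p : E, A p ->
    exists (U : set E) (g : E -> V),
      [/\ open U, U p, smooth_open U g & forall q, U q -> A q -> f q = g q].

(* f : A -> V has derivative l at t; one-sided if t is an endpoint of the
   interval A. *)
Definition is_derive_within {V : normedModType R} (A : set R) (f : R -> V)
    (t : R) (l : V) : Prop :=
  (fun s => (s - t)^-1 *: (f s - f t)) @ within A t^' --> l.

(* Nonempty, possibly unbounded. *)
Definition open_interval (J : set R) : Prop :=
  exists a b : \bar R, (a < b)%E /\ J = [set x | (a < x%:E < b)%E].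

End Smoothness.

Local Open Scope quotient_scope.

Section Angle.
Context {R : realType}.

Definition angle_rel (x y : R) : bool :=
  `[< exists k : int, y - x = k%:~R * (2 * pi) >].

Lemma angle_rel_refl : reflexive angle_rel.
Proof. by move=> x; apply/asboolP; exists 0; rewrite subrr mul0r. Qed.

Lemma angle_rel_sym : symmetric angle_rel.
Proof.
have H x y : angle_rel x y -> angle_rel y x.
  move=> /asboolP[k xy]; apply/asboolP; exists (- k).
  by rewrite -opprB xy mulrNz mulNr.
by move=> x y; apply/idP/idP; exact: H.
Qed.

Lemma angle_rel_trans : transitive angle_rel.
Proof.
move=> y x z /asboolP[k xy] /asboolP[l yz]; apply/asboolP; exists (l + k).
by rewrite mulrzDr mulrDl -xy -yz addrA subrK.
Qed.

Canonical angle_equiv :=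
  EquivRel angle_rel angle_rel_refl angle_rel_sym angle_rel_trans.

End Angle.

(* R / 2 pi Z *)
Definition angle (R : realType) : Type := {eq_quot (@angle_equiv R)}.

Section AngleTheory.
Context {R : realType}.

Definition to_angle (x : R) : angle R := \pi_({eq_quot (@angle_equiv R)}) x.

(* cos and sin of a representative; see cos_to_angle and sin_to_angle. *)
Definition cos_angle (a : angle R) : R :=
  cos (repr (a : {eq_quot (@angle_equiv R)})).
Definition sin_angle (a : angle R) : R :=
  sin (repr (a : {eq_quot (@angle_equiv R)})).

Lemma to_angleP (x y : R) :
  to_angle x = to_angle y <-> exists k : int, y - x = k%:~R * (2 * pi).
Proof.
split; first by move=> /eqmodP /asboolP.
by move=> xy; apply/eqmodP/asboolP.
Qed.

Lemma to_angle_surj (a : angle R) : exists x : R, to_angle x = a.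
Proof. by exists (repr (a : {eq_quot (@angle_equiv R)})); exact: reprK. Qed.

Lemma to_angle_periodic (g : R -> R) (x : R) : periodic g (pi *+ 2) ->
  g (repr (to_angle x : {eq_quot (@angle_equiv R)})) = g x.
Proof.
move=> gpi; set y := repr _.
have /to_angleP[k xy] : to_angle x = to_angle y by rewrite /to_angle reprK.
move: xy; rewrite mulrzl mulr_natl; case: k => n.
  by rewrite -pmulrn => /(canRL (subrK x)) ->; rewrite addrC periodicn.
rewrite NegzE mulrNz -opprB => /oppr_inj /(canRL (subrK y)) ->.
by rewrite addrC periodicn.
Qed.

Lemma cos_to_angle (x : R) : cos_angle (to_angle x) = cos x.
Proof. exact: to_angle_periodic (@cosD2pi R). Qed.

Lemma sin_to_angle (x : R) : sin_angle (to_angle x) = sin x.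
Proof. exact: to_angle_periodic (@sinD2pi R). Qed.

End AngleTheory.

Section Flow.
Context {R : realType}.
Local Notation plane := 'rV[R]_2.
Local Notation spacetime := (plane * R)%type.

Definition vec2 (a b : R) : plane := \row_(i < 2) [:: a; b]`_i.

(* The norm of the library on row vectors is the sup norm. *)
Definition enorm (v : plane) : R := Num.sqrt (\sum_(i < 2) v 0 i ^+ 2).

Definition slice (W : set spacetime) (t : R) : set plane := [set z | W (z, t)].

(* Relatively open subset of R^2 x [0, T); T = +oo is allowed. *)
Definition rel_open (T : \bar R) (W : set spacetime) : Prop :=
  exists O : set spacetime,
    open O /\ W = O `&` [set p | (0 <= p.2) /\ (p.2%:E < T)%E].

(* f is a C^oo real-valued lift of theta on the part of W lying in U. *)
Definition smooth_lift (W : set spacetime) (theta : spacetime -> angle R)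
    (U : set spacetime) (f : spacetime -> R) : Prop :=
  [/\ open U, smooth_on (W `&` U) (f : spacetime -> R^o) &
      forall p, W p -> U p -> theta p = to_angle (f p)].

Definition smooth_angle (W : set spacetime) (theta : spacetime -> angle R) :
    Prop :=
  forall p, W p -> exists U f, U p /\ smooth_lift W theta U f.

(* Partial derivative along the space coordinate y^i, time being fixed. *)
Definition partial (i : 'I_2) (f : spacetime -> R) : spacetime -> R :=
  fun p => 'D_('e_i : plane) (fun z => f (z, p.2) : R^o) p.1.

(* The equation at every point of W, for every local lift f of theta. *)
Definition angle_equation (W : set spacetime) (theta : spacetime -> angle R) :
    Prop :=
  forall U f, smooth_lift W theta U f ->
  forall z t, W (z, t) -> U (z, t) ->
    let c := cos_angle (theta (z, t)) in
    let s := sin_angle (theta (z, t)) in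
    is_derive_within [set r | W (z, r) /\ U (z, r)]
      (fun r => f (z, r) : R^o) t
      (partial 0 (partial 0 f) (z, t) * c ^+ 2
       + 2 * partial 0 (partial 1 f) (z, t) * s * c
       + partial 1 (partial 1 f) (z, t) * s ^+ 2).

Definition V1 (theta : spacetime -> angle R) (t : R) (z : plane) : plane :=
  vec2 (cos_angle (theta (z, t))) (sin_angle (theta (z, t))).

Definition integral_curve (Omega : set plane) (X : plane -> plane)
    (L : set plane) : Prop :=
  exists (J : set R) (gamma : R -> plane),
    [/\ open_interval J,
        forall s, J s -> Omega (gamma s) /\ is_derive s 1 gamma (X (gamma s)) &
        L = gamma @` J].

Definition unit_tangent (c : R -> plane) (x : R) : plane :=
  (enorm (derive1 c x))^-1 *: derive1 c x.

(* Derivative of the unit tangent with respect to arclength. *)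
Definition curvature_vector (c : R -> plane) (x : R) : plane :=
  (enorm (derive1 c x))^-1 *: derive1 (unit_tangent c) x.

Definition smooth_mcf (Ty : R) (L : R -> set plane) : Prop :=
  exists (J : set R) (F : R * R -> plane),
    [/\ open_interval J,
        smooth_on (E := (R^o * R^o)%type) (J `*` `[0, Ty[) F &
        forall t, t \in `[0, Ty[ ->
          [/\ forall x, J x -> derive1 (fun x' => F (x', t)) x != 0,
              L t = (fun x => F (x, t)) @` J &
              forall x, J x ->
                is_derive_within `[0, Ty[ (fun s => F (x, s)) t
                  (curvature_vector (fun x' => F (x', t)) x)]].

End Flow.

(* Main.v *)
Require Import Defs.
From HB Require Import structures.
From mathcomp Require Import all_boot all_order all_algebra.
From mathcomp Require Import ring lra.
From mathcomp Require Import all_classical all_reals all_analysis.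
Import Order.TTheory GRing.Theory Num.Theory.
Import numFieldNormedType.Exports.
Set Implicit Arguments.
Unset Strict Implicit.
Unset Printing Implicit Defensive.
Local Open Scope classical_set_scope.
Local Open Scope ring_scope.

(** The equation of theta says that moving points along curvature vectors keeps
    curves tangent to the direction field V = (cos theta, sin theta). Near (y, 0)
    the angle has a smooth real lift g, defined on an open set of spacetime that
    also contains negative times. Let n = (- sin g, cos g) be the normal
    direction and k = V(g) the derivative of g along V, which is the curvature of
    the integral curves of V. Start from the integral curve x |-> c(x) of
    V(., 0) through y and let F(x, t) be the position at time t of the point that
    starts at c(x) and moves with velocity k n.

    By construction F satisfies the equation of mean curvature flow provided the
    curve F(., t) is still tangent to V(., t): then its curvature vector is k n.
    Split the velocity F_x = b V + a n. Since mixed derivatives commute,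
    F_x solves the linearisation of F_t = k n, and the heat equation for g,
    which amounts to the statement that g changes at the rate V(k) along the flow
    (angle_along_flow), makes all terms without a cancel in the derivative of
    a: one finds a' = n(k) a (derive_normal_part). As a vanishes at time 0, it
    vanishes at all times in [0, T[ (curves_stay_tangent), while b > 0 near the
    initial point. Parametrising by arclength turns F(., t) into an
    integral curve (tangent_integral_curve), and the derivative of its unit
    tangent is k n (curvature_vectorE).

    The analytic ingredient is that a smooth vector field has a local flow which
    is smooth jointly in the initial point and in time (local_flow). Existence is
    Picard iteration. Smooth dependence rests on one observation: the tangent map
    of the flow of G is the flow of the tangent map of G. If differentiability of
    order n + 1 means that f is differentiable and that (x, v) |-> (f x, f'(x) v)
    is of order n (Ck), then smoothness of all flows to order n + 1 follows from
    smoothness of all flows to order n and from differentiability, which is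
    an application of Gronwall's inequality (flow_Ck). Time derivatives need no
    separate treatment: the flow of G during time t is the flow during time 1 of
    the field (x, t) |-> (t G(x), 0). *)

(** * Derivatives and the mean value inequality *)

Section Calculus.
Context {R : realType}.
Implicit Types E F V : normedModType R.

(** Division-free form of the limit of difference quotients; it makes sense at
    increment 0 as well, so that estimates can be summed and composed. *)
Lemma is_derive_epsP E F (f : E -> F) (x v : E) (l : F) :
  is_derive x v f l <->
  forall e, 0 < e -> \forall h \near (0 : R),
    `|f (x + h *: v) - f x - h *: l| <= e * `|h|.
Proof.
split.
- move=> [df dfl] e e0; have := derivable_nbhs df; rewrite dfl => Hf.
  have /eqaddoP/(_ e e0) := Hf.
  rewrite !near_simpl; apply: filterS => h /=.
  rewrite opprD -![(_ + _ : _ -> _) _]/(_ + _) -![(- _ : _ -> _) _]/(- _).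
  by rewrite /cst /= addrA [h *: v + x]addrC.
- move=> H.
  suff : (fun h => h^-1 *: ((f \o shift x) (h *: v) - f x)) @ 0^' --> l.
    by move=> fl; apply: DeriveDef; [apply: cvgP fl|apply: cvg_lim fl].
  apply/cvgrPdist_le => e e0; near_simpl; rewrite near_withinE.
  near=> h => h0 /=.
  rewrite -[l](@scalerK _ _ h) // -scalerBr normrZ normfV distrC.
  rewrite ler_pdivrMl ?normr_gt0 // mulrC [h *: v + x]addrC.
  by near: h; exact: H.
Unshelve. all: by end_near. Qed.

Lemma is_diff_eps E F (f df : E -> F) (x : E) :
  linear df -> continuous df ->
  (forall e, 0 < e -> \forall h \near (0 : E),
    `|f (x + h) - f x - df h| <= e * `|h|) ->
  is_diff x f df.
Proof.
move=> dfl dfc H.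
pose dfM := GRing.isLinear.Build _ _ _ _ _ dfl.
pose dfL : {linear _ -> _} := HB.pack df dfM.
have hd : f \o shift x = cst (f x) + dfL +o_ 0 id.
  apply/eqaddoP => e e0; rewrite near_simpl.
  apply: filterS (H e e0) => h; rewrite /= opprD.
  rewrite -![(_ + _ : _ -> _) _]/(_ + _) -![(- _ : _ -> _) _]/(- _).
  by rewrite addrA /cst /= [h + x]addrC.
have dE : 'd f x = dfL :> (E -> F) by apply: diff_unique.
by split => //; apply/diff_locallyP; rewrite dE.
Qed.

Lemma differentiable_eps E F (f : E -> F) (x : E) : differentiable f x ->
  forall e, 0 < e -> \forall h \near (0 : E),
    `|f (x + h) - f x - 'd f x h| <= e * `|h|.
Proof.
move=> /diff_locally H e e0.
have /eqaddoP/(_ e e0) := H; rewrite near_simpl.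
apply: filterS => h; rewrite /= opprD.
rewrite -![(_ + _ : _ -> _) _]/(_ + _) -![(- _ : _ -> _) _]/(- _).
by rewrite addrA /cst /= [h + x]addrC.
Qed.

Lemma derive_continuous E (f : R -> E) (s : R) (l : E) :
  is_derive s 1 f l -> {for s, continuous f}.
Proof.
by move=> H; apply/differentiable_continuous/derivable1_diffP; exact: ex_derive.
Qed.

(** The point where g(s) = |f(s) - f(a)| - (phi(s) - phi(a)) - e (s - a) is
    maximal cannot lie to the right of a: since |f'| <= phi', moving slightly
    to the left would increase g. *)
Lemma mean_value_inequality E (f f' : R -> E) (phi phi' : R -> R) (a b : R) :
  a <= b ->
  (forall s, a <= s <= b -> is_derive s 1 f (f' s)) ->
  (forall s, a <= s <= b -> is_derive s 1 phi (phi' s)) ->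
  (forall s, a <= s <= b -> `|f' s| <= phi' s) ->
  `|f b - f a| <= phi b - phi a.
Proof.
move=> ab df dphi dle.
apply/ler_addgt0Pr => e e0.
pose e' := e / (b - a + 1).
have e'0 : 0 < e' by rewrite divr_gt0 // ltr_wpDl // subr_ge0.
pose g s := `|f s - f a| - (phi s - phi a) - e' * (s - a).
have gc : {within `[a, b], continuous g}.
  apply: continuous_in_subspaceT => s; rewrite inE /= in_itv /= => sab.
  have fc := derive_continuous (df _ sab).
  have pc := derive_continuous (dphi _ sab).
  apply: cvgB; first apply: cvgB.
  - by apply: cvg_norm; apply: cvgB => //; exact: cvg_cst.
  - by apply: cvgB => //; exact: cvg_cst.
  - by apply: cvgM; [exact: cvg_cst|apply: cvgB => //; exact: cvg_cst].
have [c cab gmax] := EVT_max ab gc.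
rewrite in_itv /= in cab.
have ga : g a = 0 by rewrite /g !subrr normr0 mulr0 !subr0.
suff ca : c = a.
  have := gmax b; rewrite in_itv /= ab lexx => /(_ isT).
  rewrite ca ga /g => gb.
  have e'e : e' * (b - a) <= e.
    rewrite /e' mulrAC ler_pdivrMr ?ltr_wpDl ?subr_ge0 //.
    by rewrite ler_pM2l // lerDl.
  lra.
apply/eqP; rewrite eq_le; case/andP: (cab) => ac cb; rewrite ac andbT leNgt.
apply/negP => alc.
have e3 : 0 < e' / 3 by rewrite divr_gt0.
have /is_derive_epsP/(_ _ e3) nf := df c cab.
have /is_derive_epsP/(_ _ e3) np := dphi c cab.
have : \forall h \near (0:R), `|h| < c - a.
  by apply: nbhs0_lt; rewrite subr_gt0.
move=> nh.
have Nh (P : R -> Prop) : (\forall h \near (0:R), P h) -> \forall h \near (0:R)^'+, P (- h).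
  move=> /nbhs_ballP[d /= d0 Hd]; near=> k; apply: Hd.
  rewrite -ball_normE /= sub0r opprK gtr0_norm; last first.
    by near: k; exact: nbhs_right_gt.
  by near: k; exact: nbhs_right_lt.
near (0 : R)^'+ => h.
have h0 : 0 < h by near: h; exact: nbhs_right_gt.
have H1 : `|f (c - h) - f c + h *: f' c| <= e' / 3 * h.
  have : `|f (c + (- h) *: 1) - f c - (- h) *: f' c| <= e' / 3 * `|- h|.
    by near: h; exact: (Nh _ nf).
  by rewrite [_ *: 1]mulr1 scaleNr opprK normrN (gtr0_norm h0).
have H2 : `|phi (c - h) - phi c + h * phi' c| <= e' / 3 * h.
  have : `|phi (c + (- h) *: 1) - phi c - (- h) *: phi' c| <= e' / 3 * `|- h|.
    by near: h; exact: (Nh _ np).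
  by rewrite [_ *: 1]mulr1 scaleNr opprK normrN (gtr0_norm h0).
have hca : `|- h| < c - a by near: h; exact: (Nh _ nh).
rewrite normrN (gtr0_norm h0) in hca.
have := gmax (c - h); rewrite in_itv /=.
have -> : a <= c - h <= b by lra.
move=> /(_ isT); rewrite /g.
have T1 : `|f c - f a| <= `|f (c - h) - f a| + `|f (c - h) - f c|.
  by rewrite [leRHS]addrC [`|f (c - h) - f c|]distrC; apply: (ler_distD (f (c - h))).
have T2 : `|f (c - h) - f c| <= e' / 3 * h + h * `|f' c|.
  rewrite -[X in `|X|](addrK (h *: f' c)).
  rewrite (le_trans (ler_normB _ _)) // normrZ (gtr0_norm h0) lerD2r.
  exact: H1.
have T3 := dle c cab.
have T4 : h * `|f' c| <= h * phi' c by rewrite ler_pM2l.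
move: H2; rewrite ler_norml => /andP[_ H2].
have T5 : 0 < e' * h by rewrite mulr_gt0.
move=> Q; lra.
Unshelve. all: by end_near. Qed.

End Calculus.

(** * Gronwall's inequality and Picard iteration *)

Section Picard.
Context {R : realType}.
Implicit Types E F : normedModType R.

Lemma is_derive_expRM (a t : R) :
  is_derive t 1 (fun t => expR (a * t)) (a * expR (a * t)).
Proof.
have H : is_derive t 1 (fun t => a * t) a.
  by apply: is_derive_eq; rewrite /GRing.scale /= mulr1.
rewrite mulrC; exact: (@is_derive1_comp _ expR (fun t => a * t)).
Qed.

(** Let K be the maximum of |f(s)| exp(-2Ls). Integrating |f'| <= L |f| + e with
    |f| <= K exp(2L.) gives back K <= d + e b + K/2: the weight exp(2Ls) turns
    the integral operator into a contraction of ratio 1/2, whatever the length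
    b of the interval. *)
Lemma gronwall E (f f' : R -> E) (L e d b : R) :
  0 <= L -> 0 <= e -> 0 <= b ->
  (forall s, 0 <= s <= b -> is_derive s 1 f (f' s)) ->
  (forall s, 0 <= s <= b -> `|f' s| <= L * `|f s| + e) ->
  `|f 0| <= d ->
  forall s, 0 <= s <= b -> `|f s| <= 2 * (d + e * b) * expR (2 * L * s).
Proof.
move=> L0 e0 b0 df fle f0 s sb.
pose g t := `|f t| * expR (- (2 * L * t)).
have gc : {within `[0, b], continuous g}.
  apply: continuous_in_subspaceT => t; rewrite inE /= in_itv /= => tb.
  have fc := derive_continuous (df _ tb).
  apply: cvgM; first exact: cvg_norm.
  apply: continuous_comp; last exact: continuous_expR.
  apply: cvgN; apply: cvgM; [exact: cvg_cst|exact: cvg_id].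
have [c cb gmax] := EVT_max b0 gc.
rewrite in_itv /= in cb.
pose K := g c.
have K0 : 0 <= K by rewrite mulr_ge0 ?expR_ge0.
have fK t : 0 <= t <= b -> `|f t| <= K * expR (2 * L * t).
  move=> tb; rewrite -ler_pdivrMr ?expR_gt0 // -expRN.
  by apply: gmax; rewrite in_itv.
have /andP[c0 cb'] := cb.
have mv : `|f c - f 0| <=
    (K / 2 * expR (2 * L * c) + e * c) - (K / 2 * expR (2 * L * 0) + e * 0).
  apply: (@mean_value_inequality _ _ f f'
    (fun t => K / 2 * expR (2 * L * t) + e * t)
    (fun t => L * (K * expR (2 * L * t)) + e)) => // t /andP[t0 tc].
  - by apply: df; rewrite t0 (le_trans tc).
  - have H' := is_derive_expRM (2 * L) t.
    have -> : L * (K * expR (2 * L * t)) + e =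
      (K / 2) *: ((2 * L) * expR (2 * L * t)) + e *: 1 :> R.
      by rewrite /GRing.scale /=; field.
    exact: (is_deriveD (is_deriveZ _ H') (is_deriveZ _ (is_derive_id _ _))).
  - have tb : 0 <= t <= b by rewrite t0 (le_trans tc).
    by rewrite (le_trans (fle _ tb)) // lerD2r ler_wpM2l // fK.
rewrite !mulr0 expR0 mulr1 addr0 in mv.
have E1 : 1 <= expR (2 * L * c) by rewrite -expR0 ler_expR !mulr_ge0.
have fc : `|f c| <= `|f c - f 0| + `|f 0|.
  by rewrite -[X in `|X| <= _](subrK (f 0)) ler_normD.
have Kc : K * expR (2 * L * c) = `|f c|.
  by rewrite /K /g -mulrA -expRD addNr expR0 mulr1.
have d0 : 0 <= d by apply: le_trans f0.
have ec : e * c <= e * b by rewrite ler_wpM2l.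
have eb0 : 0 <= e * b by rewrite mulr_ge0.
have KE : K * expR (2 * L * c) <= 2 * (d + e * b) * expR (2 * L * c).
  have : 2 * (d + e * b) <= 2 * (d + e * b) * expR (2 * L * c).
    by rewrite ler_peMr // mulr_ge0 // addr_ge0.
  rewrite Kc in fc *; move: mv fc f0 Kc; set x := expR _; lra.
have {}KE : K <= 2 * (d + e * b) by move: KE; rewrite ler_pM2r ?expR_gt0.
by rewrite (le_trans (fK _ sb)) // ler_pM2r ?expR_gt0.
Qed.

(** What Picard iteration needs from the phase space: limits of sequences with
    geometrically small steps, and antiderivatives of continuous curves. Both
    pass to products, which is what the tangent construction below requires. *)
Definition picard_space E :=
  (forall (u : nat -> E) (C : R),
     (forall n, `|u n.+1 - u n| <= C / 2 ^+ n) ->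
     exists l, forall n, `|u n - l| <= 2 * C / 2 ^+ n) /\
  (forall f : R -> E, continuous f ->
     exists F : R -> E, forall s : R, 0 <= s <= 1 -> is_derive s 1 F (f s)).

Definition clamp (a b s : R) : R := Num.max a (Num.min b s).

Lemma clamp_id a b s : a <= s <= b -> clamp a b s = s.
Proof. by move=> /andP[a_s sb]; rewrite /clamp min_r // max_r. Qed.

Lemma clamp_bound a b s : a <= b -> a <= clamp a b s <= b.
Proof.
by move=> ab; rewrite /clamp le_max lexx /= ge_max ab ge_min lexx.
Qed.

Lemma clamp_continuous a b : continuous (clamp a b).
Proof.
move=> s; rewrite /clamp.
apply: (@continuous_max _ _ (fun=> a) (fun s => Num.min b s)).
  exact: cvg_cst.
apply: (@continuous_min _ _ (fun=> b) id); [exact: cvg_cst|exact: cvg_id].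
Qed.

(** Clamping extends a curve given on [a, b] continuously to the whole line, so
    that two-sided derivatives at the endpoints make sense. *)
Lemma continuous_comp_clamp E (f : R -> E) a b : a <= b ->
  (forall s, a <= s <= b -> {for s, continuous f}) ->
  continuous (f \o clamp a b).
Proof.
move=> ab fc s; apply: continuous_comp; first exact: clamp_continuous.
exact/fc/clamp_bound.
Qed.

Lemma geometric_small (C : R) : 0 <= C ->
  forall e, 0 < e -> exists n, 2 * C / 2 ^+ n < e.
Proof.
move=> C0 e e0.
have [n nP] : exists n : nat, 2 * C / e < n%:R.
  exists (Num.bound (2 * C / e)); apply: archi_boundP.
  by rewrite divr_ge0 ?mulr_ge0 // ltW.
exists n; rewrite ltr_pdivrMr ?exprn_gt0 // [ltRHS]mulrC -ltr_pdivrMr //.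
by rewrite (lt_trans nP) // -natrX ltr_nat ltn_expl.
Qed.

(** The iterates X_(n+1)' = B(s, X_n) satisfy
    |X_(n+1) - X_n| <= C 2^-n exp(2Ls), by the same weight as in Gronwall's
    inequality. Their limit Y on [0, 1] is continuous, and one further
    integration of B(s, Y) yields a differentiable curve that is again the
    limit, hence equals Y. *)
Lemma picard E (B : R -> E -> E) (L : R) (x0 : E) :
  picard_space E -> 0 <= L ->
  (forall s y z, `|B s y - B s z| <= L * `|y - z|) ->
  (forall Y : R -> E, continuous Y -> continuous (fun s => B s (Y s))) ->
  exists X : R -> E, X 0 = x0 /\
    forall s : R, 0 <= s <= 1 -> is_derive s 1 X (B s (X s)).
Proof.
move=> [Ecomp Eprim] L0 BL Bc.
pose cont (Y : R -> E) := forall s : R, 0 <= s <= 1 -> {for s, continuous Y}.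
have /choice[step stepP] : forall Y : R -> E, exists Z : R -> E, cont Y ->
    Z 0 = x0 /\ forall s : R, 0 <= s <= 1 -> is_derive s 1 Z (B s (Y s)).
  move=> Y; have [Yc|nYc] := pselect (cont Y); last by exists Y.
  have /Eprim[Z Zd] := Bc _ (continuous_comp_clamp ler01 Yc).
  exists (fun s => Z s + (x0 - Z 0)) => _; split; first by rewrite addrC subrK.
  move=> s s01; rewrite -[B s _]addr0.
  have := Zd _ s01; rewrite /= clamp_id // => H.
  exact: (is_deriveD H (is_derive_cst _ _ _)).
have stepc Y : cont Y -> cont (step Y).
  by move=> /stepP[_ H] s /H; exact: derive_continuous.
pose X n := iter n step (fun=> x0).
have Xc n : cont (X n).
  by elim: n => [s _|n IH]; [exact: cvg_cst|exact: stepc].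
have X0 n : X n 0 = x0.
  by case: n => // n; have [] := stepP _ (Xc n).
have XS n (s : R) : 0 <= s <= 1 -> is_derive s 1 (X n.+1) (B s (X n s)).
  by have [_] := stepP _ (Xc n); exact.
have [c _ cmax] : exists2 c, c \in `[0, 1]%R &
    forall t, t \in `[0, 1]%R -> `|X 1%N t - X 0%N t| <= `|X 1%N c - X 0%N c|.
  apply: EVT_max => //; apply: continuous_in_subspaceT => t.
  rewrite inE /= in_itv /= => t01; apply: cvg_norm.
  by apply: cvgB; [exact: (Xc 1%N)|exact: (Xc 0%N)].
set C := `|X 1%N c - X 0%N c| in cmax.
have C0 : 0 <= C by exact: normr_ge0.
have XX n (s : R) : 0 <= s <= 1 ->
    `|X n.+1 s - X n s| <= C / 2 ^+ n * expR (2 * L * s).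
  elim: n s => [|n IH] s s01.
    rewrite expr0 divr1 (le_trans (cmax s _)) ?in_itv //.
    rewrite ler_peMr ?normr_ge0 // -expR0 ler_expR.
    by case/andP: s01 => s0 _; rewrite !mulr_ge0.
  have /andP[s0 s1] := s01.
  have : `|(X n.+2 s - X n.+1 s) - (X n.+2 0 - X n.+1 0)| <=
      C / 2 ^+ n.+1 * expR (2 * L * s) - C / 2 ^+ n.+1 * expR (2 * L * 0).
    apply: (@mean_value_inequality _ _ (fun s => X n.+2 s - X n.+1 s)
       (fun s => B s (X n.+1 s) - B s (X n s))
       (fun s => C / 2 ^+ n.+1 * expR (2 * L * s))
       (fun s => L * (C / 2 ^+ n * expR (2 * L * s)))) => // t /andP[t0 ts].
    - have t01 : 0 <= t <= 1 by rewrite t0 (le_trans ts).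
      exact: (is_deriveB (XS _ _ t01) (XS _ _ t01)).
    - have H' := is_derive_expRM (2 * L) t.
      have -> : L * (C / 2 ^+ n * expR (2 * L * t)) =
        (C / 2 ^+ n.+1) *: ((2 * L) * expR (2 * L * t)) :> R.
        rewrite /GRing.scale /= exprS; field.
        by rewrite expf_neq0.
      exact: (is_deriveZ _ H').
    - have t01 : 0 <= t <= 1 by rewrite t0 (le_trans ts).
      by rewrite (le_trans (BL _ _ _)) // ler_wpM2l // IH.
  rewrite !X0 subrr subr0 => /le_trans; apply.
  by rewrite gerBl mulr_ge0 ?expR_ge0 // divr_ge0 ?exprn_ge0.
pose C' := C * expR (2 * L).
have XC n (s : R) : 0 <= s <= 1 -> `|X n.+1 s - X n s| <= C' / 2 ^+ n.
  move=> s01; rewrite (le_trans (XX _ _ s01)) // /C' mulrAC.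
  rewrite ler_wpM2r ?invr_ge0 ?exprn_ge0 // ler_wpM2l //.
  by rewrite ler_expR ler_piMr ?mulr_ge0 //; case/andP: s01.
have /choice[Y YP] : forall s, exists l, forall n,
    `|X n (clamp 0 1 s) - l| <= 2 * C' / 2 ^+ n.
  by move=> s; apply: Ecomp => n; apply/XC/clamp_bound.
have small e : 0 < e -> exists n, 2 * C' / 2 ^+ n < e.
  by apply: geometric_small; rewrite mulr_ge0 ?expR_ge0.
have Yc : continuous Y.
  move=> s; apply/cvgrPdist_le => e e0.
  have [n nP] := small (e / 3) (divr_gt0 e0 (ltr0n _ 3)).
  have Xnc : {for s, continuous (X n \o clamp 0 1)}.
    by apply: continuous_comp_clamp => //; exact: Xc.
  have e3 : 0 < e / 3 by rewrite divr_gt0.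
  move/cvgrPdist_le: Xnc => /(_ _ e3); apply: filterS => t /= Ht.
  have Hs := YP s n; have Ht' := YP t n.
  have -> : Y s - Y t = - (X n (clamp 0 1 s) - Y s)
     + (X n (clamp 0 1 s) - X n (clamp 0 1 t)) + (X n (clamp 0 1 t) - Y t).
    by rewrite opprB !addrA !subrK.
  rewrite (le_trans (ler_normD _ _)) //.
  rewrite (le_trans (lerD (ler_normD _ _) (lexx _))) // normrN.
  lra.
have [Z0 ZP] := stepP Y (fun s _ => Yc s).
set Z := step Y in Z0 ZP.
(* Z and Y are both limits of the iterates. *)
have ZY (s : R) : 0 <= s <= 1 -> Z s = Y s.
  move=> s01; apply/eqP; rewrite -subr_eq0 -normr_le0.
  apply/ler_addgt0Pr => e e0; rewrite add0r.
  have eL : 0 < e / (L + 1) by rewrite divr_gt0 // ltr_wpDl.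
  have [n nP] := small _ eL.
  have /andP[s0 s1] := s01.
  have H1 : `|(Z s - X n.+1 s) - (Z 0 - X n.+1 0)| <=
     L * (2 * C' / 2 ^+ n) * s - L * (2 * C' / 2 ^+ n) * 0.
    apply: (@mean_value_inequality _ _ (fun s => Z s - X n.+1 s)
       (fun s => B s (Y s) - B s (X n s))
       (fun s => L * (2 * C' / 2 ^+ n) * s)
       (fun s => L * (2 * C' / 2 ^+ n))) => // t /andP[t0 ts].
    - have t01 : 0 <= t <= 1 by rewrite t0 (le_trans ts).
      exact: (is_deriveB (ZP _ t01) (XS _ _ t01)).
    - by apply: is_derive_eq; rewrite /GRing.scale /= mulr1.
    - have t01 : 0 <= t <= 1 by rewrite t0 (le_trans ts).
      rewrite (le_trans (BL _ _ _)) // ler_wpM2l // distrC.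
      by have := YP t n; rewrite clamp_id.
  rewrite Z0 X0 subrr subr0 mulr0 subr0 in H1.
  have H2 : `|X n.+1 s - Y s| <= 2 * C' / 2 ^+ n.
    have := YP s n.+1; rewrite clamp_id // => /le_trans; apply.
    rewrite ler_wpM2l ?mulr_ge0 ?expR_ge0 //.
    rewrite lef_pV2 ?posrE ?exprn_gt0 //.
    by rewrite exprS ler_peMl ?exprn_ge0 // ler1n.
  have q0 : 0 <= 2 * C' / 2 ^+ n.
    by rewrite !mulr_ge0 ?invr_ge0 ?exprn_ge0 ?expR_ge0.
  have H3 : L * (2 * C' / 2 ^+ n) * s <= L * (2 * C' / 2 ^+ n).
    by rewrite ler_piMr // mulr_ge0.
  have -> : Z s - Y s = (Z s - X n.+1 s) + (X n.+1 s - Y s).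
    by rewrite addrA subrK.
  rewrite (le_trans (ler_normD _ _)) //.
  move: nP; rewrite ltr_pdivlMr ?ltr_wpDl //.
  lra.
exists Z; split => // s s01; have := ZP _ s01.
by rewrite -(ZY _ s01).
Qed.

End Picard.

(** * Calculus of C^n maps through tangent maps *)

Section Smooth.
Context {R : realType}.
Implicit Types E F G : normedModType R.

Lemma continuous_pair (S T U : topologicalType) (f : S -> T) (g : S -> U)
    (x : S) : {for x, continuous f} -> {for x, continuous g} ->
  {for x, continuous (fun y => (f y, g y))}.
Proof. exact: cvg_pair. Qed.

Lemma is_diff_linear E F (f : E -> F) (x : E) :
  linear f -> continuous f -> is_diff x f f.
Proof.
move=> fl fc.
pose fM := GRing.isLinear.Build _ _ _ _ _ fl.
pose fL : {linear _ -> _} := HB.pack f fM.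
apply: DiffDef; first exact: (@linear_differentiable _ _ _ fL).
exact: (@diff_lin _ _ _ fL).
Qed.

Lemma is_diff_derive E F (f df : E -> F) (x v : E) :
  is_diff x f df -> 'D_v f x = df v.
Proof. by move=> H; rewrite deriveE // diff_val. Qed.

Lemma is_diff_is_derive E F (f df : E -> F) (x v : E) :
  is_diff x f df -> is_derive x v f (df v).
Proof.
move=> H; apply: DeriveDef; first exact: diff_derivable.
exact: is_diff_derive.
Qed.

Lemma near_eq_differentiable E F (f g : E -> F) (x : E) :
  {near x, f =1 g} -> differentiable f x -> differentiable g x.
Proof.
move=> fg df; suff : is_diff x g ('d f x) by move=> H; exact: ex_diff.
apply: is_diff_eps; [exact: linearP|exact: diff_continuous|move=> e e0].
have := differentiable_eps df e0.
rewrite -(nbhs_singleton fg).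
have : \forall h \near (0 : E), f (x + h) = g (x + h).
  suff : (fun h => x + h) @ (0 : E) --> x by move=> H; exact: (H _ fg).
  by rewrite -[X in _ --> X]addr0; apply: cvgD; [exact: cvg_cst|exact: cvg_id].
by apply: filterS2 => h ->.
Qed.

Definition tangent E F (f : E -> F) (p : E * E) : F * F :=
  (f p.1, 'D_(p.2) f p.1).

(** A map is C^(n+1) when it is differentiable and its tangent map
    (x, v) |-> (f x, f'(x) v) is C^n. The tangent map of a composite is the
    composite of the tangent maps, so that the rules of calculus hold at every
    order by plain induction, without formulas for higher derivatives. On
    finite dimensional spaces this is the usual notion. *)
Fixpoint Ck (n : nat) : forall E F, set E -> (E -> F) -> Prop :=
  match n with
  | 0 => fun E F U f => forall x, U x -> {for x, continuous f}
  | n.+1 => fun E F U f => (forall x, U x -> differentiable f x) /\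
      Ck n (U `*` setT) (tangent f)
  end.

Lemma near_open (E : topologicalType) (U : set E) (x : E) (P : E -> Prop) :
  open U -> U x -> (forall y, U y -> P y) -> \near x, P x.
Proof. by move=> Uo Ux UP; apply: filterS UP _; exact: open_nbhs_nbhs. Qed.

Lemma open_setX_setT (E F : topologicalType) (U : set E) :
  open U -> open (U `*` [set: F]).
Proof.
move=> Uo; rewrite (_ : _ `*` _ = fst @^-1` U); last first.
  by apply/seteqP; split=> [[x y] []|[x y]] /=.
by apply: open_comp => // p _; exact: cvg_fst.
Qed.

(** Derivatives of f at points of an open U only see f on U, although tangent f
    is defined from values of f everywhere. *)
Lemma eq_Ck n E F (U : set E) (f g : E -> F) : open U ->
  (forall x, U x -> f x = g x) -> Ck n U f -> Ck n U g.
Proof.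
elim: n E F U f g => [|n IH] E F U f g Uo fg /=.
  move=> fc x Ux; have fgx : {near x, f =1 g} by exact: (near_open Uo Ux).
  have : f @ x --> f x by exact: fc.
  rewrite (fg _ Ux) => fx; apply: cvg_trans fx; exact: near_eq_cvg.
move=> [df Tf]; split=> [x Ux|].
  by apply: near_eq_differentiable (df _ Ux); exact: (near_open Uo Ux).
apply: IH Tf; first exact: open_setX_setT.
move=> [x v] [/= Ux _]; rewrite /tangent /= fg //.
by congr pair; apply: near_eq_derive; exact: (near_open Uo Ux).
Qed.

Lemma Ck_sub n E F (U V : set E) (f : E -> F) :
  V `<=` U -> Ck n U f -> Ck n V f.
Proof.
elim: n E F U V f => [|n IH] E F U V f VU /=.
  by move=> fc x /VU; exact: fc.
move=> [df Tf]; split; first by move=> x /VU; exact: df.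
by apply: IH Tf => -[x v] [/= /VU Ux _].
Qed.

Lemma Ck_continuous n E F (U : set E) (f : E -> F) (x : E) :
  Ck n U f -> U x -> {for x, continuous f}.
Proof.
case: n => [|n] /=; first exact.
by move=> [df _] /df; exact: differentiable_continuous.
Qed.

Lemma CkS_Ck n E F (U : set E) (f : E -> F) : Ck n.+1 U f -> Ck n U f.
Proof.
elim: n E F U f => [|n IH] E F U f; last by move=> [df /IH].
by move=> H x; exact: Ck_continuous H.
Qed.

Lemma CkS n E F (U : set E) (f : E -> F) (f' : E -> E -> F) : open U ->
  (forall x, U x -> is_diff x f (f' x)) ->
  Ck n (U `*` setT) (fun p : E * E => (f p.1, f' p.1 p.2)) ->
  Ck n.+1 U f.
Proof.
move=> Uo df Tf; split; first by move=> x /df.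
apply: eq_Ck Tf; first exact: open_setX_setT.
move=> [x v] [/= /df H _].
by rewrite /tangent /= (is_diff_derive _ H).
Qed.

Lemma Ck_comp n E F G (U : set E) (V : set F) (f : E -> F) (g : F -> G) :
  open U -> (forall x, U x -> V (f x)) ->
  Ck n U f -> Ck n V g -> Ck n U (g \o f).
Proof.
elim: n E F G U V f g => [|n IH] E F G U V f g Uo UV /=.
  move=> fc gc x Ux; apply: continuous_comp; first exact: fc.
  exact/gc/UV.
move=> [df Tf] [dg Tg]; split.
  by move=> x Ux; apply: differentiable_comp; [exact: df|exact/dg/UV].
have := IH _ _ _ _ _ _ _ (open_setX_setT Uo) _ Tf Tg.
move=> /(_ (fun p Up => conj (UV _ Up.1) I)).
apply: eq_Ck; first exact: open_setX_setT.
move=> [x v] [/= Ux _]; rewrite /tangent /=; congr pair.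
have := df _ Ux; have := dg _ (UV _ Ux) => dg' df'.
rewrite !deriveE //; last exact: differentiable_comp.
by rewrite (diff_comp df' dg').
Qed.

Lemma Ck_linear n E F (U : set E) (f : E -> F) : open U ->
  linear f -> continuous f -> Ck n U f.
Proof.
elim: n E F U f => [|n IH] E F U f Uo fl fc; first by move=> x _; exact: fc.
apply: (@CkS _ _ _ _ _ (fun=> f)) => //.
  by move=> x _; exact: is_diff_linear.
apply: IH; first exact: open_setX_setT.
  by move=> k [x v] [x' v'] /=; rewrite !fl.
move=> p; apply: continuous_pair.
  by apply: (@continuous_comp _ _ _ fst f); [exact: cvg_fst|exact: fc].
by apply: (@continuous_comp _ _ _ snd f); [exact: cvg_snd|exact: fc].
Qed.

Lemma Ck_id n E (U : set E) : open U -> Ck n U (id : E -> E).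
Proof. by move=> Uo; apply: Ck_linear => // x; exact: cvg_id. Qed.

Lemma Ck_fst n E F (U : set (E * F)) : open U -> Ck n U (fst : E * F -> E).
Proof. by move=> Uo; apply: Ck_linear => // -[x y]; exact: cvg_fst. Qed.

Lemma Ck_snd n E F (U : set (E * F)) : open U -> Ck n U (snd : E * F -> F).
Proof. by move=> Uo; apply: Ck_linear => // -[x y]; exact: cvg_snd. Qed.

Lemma Ck_cst n E F (U : set E) (a : F) : open U -> Ck n U (fun _ : E => a).
Proof.
elim: n E F U a => [|n IH] E F U a Uo; first by move=> x _; exact: cvg_cst.
apply: (@CkS _ _ _ _ _ (fun _ _ => 0)) => //.
exact: (IH _ _ _ (a, 0) (open_setX_setT Uo)).
Qed.

(** The tangent map of (f, g) is the pair of tangent maps up to the exchange of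
    the two middle factors, a linear map. *)
Lemma Ck_pair n E F G (U : set E) (f : E -> F) (g : E -> G) : open U ->
  Ck n U f -> Ck n U g -> Ck n U (fun x => (f x, g x)).
Proof.
elim: n E F G U f g => [|n IH] E F G U f g Uo.
  by move=> fc gc x Ux; apply: continuous_pair; [exact: fc|exact: gc].
move=> [df Tf] [dg Tg].
apply: (@CkS _ _ _ _ _ (fun x v => ('D_v f x, 'D_v g x))) => //.
  move=> x Ux; have df' := df _ Ux; have dg' := dg _ Ux.
  have := is_diff_pair (differentiableP df') (differentiableP dg').
  congr is_diff_def; apply/funext => v /=.
  by rewrite !deriveE.
pose shuffle (p : (F * F) * (G * G)) := ((p.1.1, p.2.1), (p.1.2, p.2.2)).
have U'o := @open_setX_setT _ E _ Uo.
have := IH _ _ _ _ _ _ U'o Tf Tg.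
have shC : Ck n setT shuffle.
  apply: Ck_linear => //; first exact: openT.
  move=> p; apply: continuous_pair; apply: continuous_pair.
  - by apply: (@continuous_comp _ _ _ fst fst); [exact: cvg_fst|exact: cvg_fst].
  - by apply: (@continuous_comp _ _ _ snd fst); [exact: cvg_snd|exact: cvg_fst].
  - by apply: (@continuous_comp _ _ _ fst snd); [exact: cvg_fst|exact: cvg_snd].
  - by apply: (@continuous_comp _ _ _ snd snd); [exact: cvg_snd|exact: cvg_snd].
by move=> /(Ck_comp U'o)/(_ shC); exact.
Qed.

Lemma Ck_add n E F (U : set E) (f g : E -> F) : open U ->
  Ck n U f -> Ck n U g -> Ck n U (fun x => f x + g x).
Proof.
move=> Uo fC gC.
apply: (@Ck_comp _ _ _ _ _ setT (fun x => (f x, g x)) (fun p => p.1 + p.2)) => //.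
  exact: Ck_pair.
apply: Ck_linear; first exact: openT.
  by move=> k [a b] [c d] /=; rewrite scalerDr addrACA.
by move=> [a b]; apply: cvgD; [exact: cvg_fst|exact: cvg_snd].
Qed.

Lemma Ck_linear_comp n E F G (U : set E) (f : E -> F) (l : F -> G) :
  open U -> linear l -> continuous l -> Ck n U f -> Ck n U (fun x => l (f x)).
Proof.
move=> Uo ll lc fC; apply: (@Ck_comp _ _ _ _ _ setT f l) => //.
by apply: Ck_linear => //; exact: openT.
Qed.

Lemma Ck_opp n E F (U : set E) (f : E -> F) : open U ->
  Ck n U f -> Ck n U (fun x => - f x).
Proof.
move=> Uo; apply: Ck_linear_comp => //.
  by move=> k x y; rewrite opprD scalerN.
by move=> x; apply: cvgN; exact: cvg_id.
Qed.

Lemma bilinear_increment E (a b : R) (x y : E) :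
  (a + b) *: (x + y) - a *: x - (a *: y + b *: x) = b *: y.
Proof. by rewrite scalerDl !scalerDr -addrA -opprD !addrA addrC addKr. Qed.

Lemma is_diff_scale E (p : R * E) :
  is_diff p (fun p : R * E => p.1 *: p.2) (fun q => p.1 *: q.2 + q.1 *: p.2).
Proof.
apply: is_diff_eps.
- move=> k [a b] [c d] /=; rewrite !scalerDr !scalerDl.
  by rewrite !scalerA [p.1 * k]mulrC addrACA.
- move=> q; apply: cvgD; apply: cvgZ; try exact: cvg_cst.
    exact: cvg_snd.
  exact: cvg_fst.
- move=> e e0; apply: filterS (@nbhs0_le _ (R * E)%type _ e0) => h he.
  have -> : (p + h).1 *: (p + h).2 - p.1 *: p.2 - (p.1 *: h.2 + h.1 *: p.2)
     = h.1 *: h.2.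
    exact: bilinear_increment.
  rewrite normrZ.
  have h1 : `|h.1| <= `|h| by rewrite prod_normE le_max lexx.
  have h2 : `|h.2| <= `|h| by rewrite prod_normE le_max lexx orbT.
  by rewrite ler_pM // (le_trans h1).
Qed.

(** By induction: the derivative of a *: v is a sum of two products of the same
    form. *)
Lemma Ck_scale n E F (U : set E) (f : E -> R) (g : E -> F) : open U ->
  Ck n U f -> Ck n U g -> Ck n U (fun x => f x *: g x).
Proof.
move=> Uo; elim: n E F U f g Uo => [|n IH] E F U f g Uo.
  by move=> fc gc x Ux; apply: cvgZ; [exact: fc|exact: gc].
move=> fC gC.
apply: (@Ck_comp _ _ _ _ _ setT (fun x => (f x, g x)) (fun p => p.1 *: p.2)) => //.
  exact: Ck_pair.
apply: CkS; [exact: openT|by move=> p _; exact: is_diff_scale|].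
set V := _ `*` _; have Vo : open V by apply: open_setX_setT; exact: openT.
have C1 : Ck n V fst by exact: Ck_fst.
have C2 : Ck n V snd by exact: Ck_snd.
have c1 : continuous (fst : R * F -> R) by move=> p; exact: cvg_fst.
have c2 : continuous (snd : R * F -> F) by move=> p; exact: cvg_snd.
have C11 := Ck_linear_comp Vo (fun _ _ _ => erefl) c1 C1.
have C12 := Ck_linear_comp Vo (fun _ _ _ => erefl) c2 C1.
have C21 := Ck_linear_comp Vo (fun _ _ _ => erefl) c1 C2.
have C22 := Ck_linear_comp Vo (fun _ _ _ => erefl) c2 C2.
apply: Ck_pair => //; first exact: IH.
by apply: Ck_add => //; apply: IH.
Qed.

(** Each of the two functions is, up to sign, the derivative of the other. *)
Lemma Ck_cos_sin n : Ck n setT (@cos R) /\ Ck n setT (@sin R).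
Proof.
elim: n => [|n [IHc IHs]].
  by split=> x _; [exact: continuous_cos|exact: continuous_sin].
have dR (f f' : R -> R) (x : R) : is_derive x 1 f (f' x) ->
    is_diff x f (fun v => v * f' x).
  move=> [fd <-]; apply: DiffDef; first exact/derivable1_diffP.
  by rewrite deriv1E // derive1E.
have To : open ([set: R] `*` [set: R]) by apply: open_setX_setT; exact: openT.
have C1 : Ck n ([set: R] `*` [set: R]) fst by exact: Ck_fst.
have C2 : Ck n ([set: R] `*` [set: R]) snd by exact: Ck_snd.
have cc := Ck_comp To (fun _ _ => I) C1 IHc.
have cs := Ck_comp To (fun _ _ => I) C1 IHs.
have dcos (x : R) : is_diff x (@cos R) (fun v => v * - sin x).
  exact: (dR _ (fun x => - sin x)).
have dsin (x : R) : is_diff x (@sin R) (fun v => v * cos x) by exact: dR.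
split.
- apply: (CkS openT (fun x _ => dcos x)).
  by apply: Ck_pair => //; apply: (@Ck_scale _ _ R) => //; apply: Ck_opp.
- apply: (CkS openT (fun x _ => dsin x)).
  by apply: Ck_pair => //; apply: (@Ck_scale _ _ R).
Qed.

End Smooth.

(** * From iterated partial derivatives to C^n maps and back *)

Section SmoothOpen.
Context {R : realType}.
Implicit Types E F G : normedModType R.

Definition smooth E F (U : set E) (f : E -> F) := forall n, Ck n U f.

Lemma Ck_derive n E F (U : set E) (f : E -> F) (v : E) : open U ->
  Ck n.+1 U f -> Ck n U ('D_v f).
Proof.
move=> Uo [_ Tf].
have C1 : Ck n U (fun x : E => (x, v)).
  by apply: Ck_pair => //; [exact: Ck_id|exact: Ck_cst].
have C2 := Ck_comp Uo (fun x (Ux : U x) => conj Ux I) C1 Tf.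
apply: (@Ck_comp _ _ _ _ _ _ setT (fun x => tangent f (x, v)) snd) => //.
by apply: Ck_snd; exact: openT.
Qed.

Lemma smooth_derive E F (U : set E) (f : E -> F) (v : E) : open U ->
  smooth U f -> smooth U ('D_v f).
Proof. by move=> Uo fS n; exact: Ck_derive. Qed.

Lemma smooth_is_diff E F (U : set E) (f : E -> F) x : open U ->
  smooth U f -> U x -> is_diff x f (fun v => 'D_v f x).
Proof.
move=> Uo fS Ux; have [/(_ _ Ux) df _] := fS 1%N.
apply: DiffDef => //; apply/funext => v; by rewrite deriveE.
Qed.

Lemma smooth_smooth_open E F (U : set E) (f : E -> F) : open U ->
  smooth U f -> smooth_open U f.
Proof.
move=> Uo fS vs p Up; have gS : smooth U (iter_derive f vs).
  by elim: vs => [|v vs IH] //=; exact: smooth_derive.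
split; first exact: (Ck_continuous (gS 0%N)).
by move=> v; apply: diff_derivable; have [+ _] := gS 1%N; exact.
Qed.

Lemma is_derive_scalel F (r : R) (a : F) :
  is_derive r 1 (fun r : R => r *: a) a.
Proof.
apply/is_derive_epsP => e e0; apply: filterE => h.
rewrite [h *: 1]mulr1 scalerDl [r *: a + _]addrC addrK subrr normr0.
by rewrite mulr_ge0 // ltW.
Qed.

Lemma is_derive_line E F (f : E -> F) (y v : E) (r : R) (l : F) :
  is_derive (y + r *: v) v f l -> is_derive r 1 (fun r => f (y + r *: v)) l.
Proof.
move=> /is_derive_epsP H; apply/is_derive_epsP => e /H.
by apply: filterS => h; rewrite [h *: 1]mulr1 scalerDl addrA.
Qed.

Lemma is_derive_scalev E F (f : E -> F) (x v : E) (k : R) (l : F) :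
  is_derive x v f l -> is_derive x (k *: v) f (k *: l).
Proof.
move=> /is_derive_epsP H; apply/is_derive_epsP => e e0.
have k0 : 0 < `|k| + 1 by rewrite ltr_wpDl.
have := H _ (divr_gt0 e0 k0) => Hn.
have kc : (fun h : R => h * k) @ (0 : R) --> (0 : R).
  rewrite -[X in _ --> X](mul0r k).
  by apply: cvgM; [exact: cvg_id|exact: cvg_cst].
have : \forall h \near (0 : R), `|f (x + (h * k) *: v) - f x - (h * k) *: l| <=
    e / (`|k| + 1) * `|h * k| by exact: (kc _ Hn).
apply: filterS => h; rewrite !scalerA => /le_trans; apply.
rewrite normrM.
have -> : e / (`|k| + 1) * (`|h| * `|k|) = e * `|h| * (`|k| / (`|k| + 1)).
  by field; rewrite gt_eqF.
by rewrite ler_piMr ?mulr_ge0 ?(ltW e0) // ler_pdivrMr // mul1r lerDl.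
Qed.

(** The mean value inequality along a segment in the direction e, uniformly in
    the base point y: the increments in the successive coordinate directions
    start from moving points. *)
Lemma partial_increment E F (f : E -> F) (U : set E) (x e : E) : open U ->
  U x -> (forall y, U y -> derivable f y e) ->
  {for x, continuous ('D_e f)} ->
  forall eps, 0 < eps -> \forall y \near x & s \near (0 : R),
    `|f (y + s *: e) - f y - s *: 'D_e f x| <= eps * `|s|.
Proof.
move=> Uo Ux df dfc eps eps0.
have : \forall z \near x, U z /\ `|'D_e f x - 'D_e f z| <= eps.
  apply: filterI; first exact: open_nbhs_nbhs.
  by move/cvgrPdist_le : dfc; apply.
move=> /nbhs_normP[d /= d0 Hd].
have d2 : 0 < d / 2 by rewrite divr_gt0.
have e1 : 0 < `|e| + 1 by rewrite ltr_wpDl.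
exists (ball x (d / 2), ball (0 : R) (d / 2 / (`|e| + 1))) => /=.
  by split; apply: nbhsx_ballx; rewrite ?divr_gt0.
move=> [y s] [] /=; rewrite -!ball_normE /= sub0r normrN => yx s0.
have Hr r : 0 <= r <= 1 -> U (y + r *: (s *: e)) /\
    `|'D_e f x - 'D_e f (y + r *: (s *: e))| <= eps.
  move=> /andP[r0 r1]; apply: Hd => /=.
  rewrite opprD addrA (le_lt_trans (ler_normB _ _)) //.
  rewrite [ltRHS]splitr ltrD // !normrZ.
  have : `|s| * `|e| < d / 2.
    move: s0; rewrite ltr_pdivlMr // => /le_lt_trans; apply.
    by rewrite ler_wpM2l // lerDl.
  apply: le_lt_trans; rewrite (ger0_norm r0).
  by rewrite ler_piMl // mulr_ge0.
have := @mean_value_inequality _ _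
  (fun r => f (y + r *: (s *: e)) - r *: (s *: 'D_e f x))
  (fun r => s *: 'D_e f (y + r *: (s *: e)) - 1 *: (s *: 'D_e f x))
  (fun r => (eps * `|s|) * r) (fun=> eps * `|s|) 0 1 ler01.
rewrite !scale1r !scale0r addr0 subr0 mulr1 mulr0 subr0 addrAC; apply.
- move=> r /Hr[Ur _]; apply: is_deriveB.
    by apply: is_derive_line; apply: is_derive_scalev; exact/derivableP/df.
  exact: is_derive_scalel.
- by move=> r _; apply: is_derive_eq; rewrite /GRing.scale /= mulr1.
- move=> r /Hr[_]; rewrite -scalerBr normrZ distrC mulrC => H.
  by rewrite ler_wpM2r.
Qed.

(** A finite basis e_0, ..., e_(m-1) with its dual continuous coordinate forms.
    Both families are indexed by nat and only their first m terms form the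
    basis; this keeps inductions on partial sums free of dependent indices. *)
Definition frame E (m : nat) (c : nat -> E -> R) (e : nat -> E) :=
  [/\ forall i, linear (c i : E -> R^o), forall i, continuous (c i) &
      forall h, h = \sum_(i < m) c i h *: e i].

Lemma linear_at0 E F (l : E -> F) : linear l -> l 0 = 0.
Proof. by move=> /(_ (-1) 0 0); rewrite !scaleN1r !addNr. Qed.

Lemma linear_bound E F (l : E -> F) : linear l -> continuous l ->
  exists2 M, 0 < M & forall h, `|l h| <= M * `|h|.
Proof.
move=> ll lc.
pose lM := GRing.isLinear.Build _ _ _ _ _ ll.
pose lL : {linear _ -> _} := HB.pack l lM.
have [M [M0 HM]] := @linear_lipschitz _ _ _ lL lc.
by exists M => // h; exact: HM.
Qed.

Lemma linear_sum_scale E F m (c : nat -> E -> R) (a : nat -> F) :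
  (forall i, linear (c i : E -> R^o)) ->
  linear (fun h => \sum_(i < m) c i h *: a i).
Proof.
move=> cl k x y; rewrite scaler_sumr -big_split /=; apply: eq_bigr => i _.
by rewrite cl scalerDl scalerA.
Qed.

Lemma continuous_sum_scale E F m (c : nat -> E -> R) (a : nat -> F) :
  (forall i, continuous (c i)) ->
  continuous (fun h => \sum_(i < m) c i h *: a i).
Proof.
move=> cc x; elim: m => [|m IH].
  rewrite (_ : (fun h => _) = fun=> 0); first exact: cvg_cst.
  by apply/funext => h; rewrite big_ord0.
rewrite (_ : (fun h => _) = fun h => \sum_(i < m) c i h *: a i + c m h *: a m).
  by apply: cvgD; [exact: IH|apply: cvgZ; [exact: cc|exact: cvg_cst]].
by apply/funext => h; rewrite big_ord_recr.
Qed.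

Lemma telescope_increment (V : zmodType) (a b c s d : V) :
  a - b - (s + d) = (c - b - s) + (a - c - d).
Proof.
rewrite opprD addrA [RHS]addrA; congr (_ - _).
by rewrite [RHS]addrC !addrA subrK.
Qed.

(** Continuous partial derivatives imply differentiability: walk from x to x + h
    along the basis directions, one coordinate after the other. *)
Lemma frame_is_diff E F m c e (f : E -> F) (U : set E) (x : E) :
  frame m c e -> open U -> U x ->
  (forall i y, U y -> derivable f y (e i)) ->
  (forall i, {for x, continuous ('D_(e i) f)}) ->
  is_diff x f (fun h => \sum_(i < m) c i h *: 'D_(e i) f x).
Proof.
move=> [cl cc hE] Uo Ux df dfc.
apply: is_diff_eps.
- exact: (@linear_sum_scale _ _ m c (fun i => 'D_(e i) f x)).
- exact: (@continuous_sum_scale _ _ m c (fun i => 'D_(e i) f x)).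
move=> eps eps0.
have claim k eps' : 0 < eps' -> \forall h \near (0 : E),
    `|f (x + \sum_(i < k) c i h *: e i) - f x
      - \sum_(i < k) c i h *: 'D_(e i) f x| <= eps' * `|h|.
  elim: k eps' => [|k IH] eps' eps'0.
    apply: filterE => h.
    by rewrite !big_ord0 addr0 subrr subr0 normr0 mulr_ge0 // ltW.
  have [M M0 HM] := linear_bound (cl k) (cc k).
  have e2 : 0 < eps' / 2 by rewrite divr_gt0.
  have eM : 0 < eps' / 2 / M by rewrite divr_gt0.
  have := partial_increment Uo Ux (df k) (dfc k) eM.
  have yc : (fun h => x + \sum_(i < k) c i h *: e i) @ (0 : E) --> x.
    rewrite -[X in _ --> X]addr0; apply: cvgD; first exact: cvg_cst.
    have := @continuous_sum_scale _ _ k c e cc 0.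
    rewrite /continuous_at (_ : (\sum_(i < k) c i 0 *: e i) = 0) //.
    by rewrite big1 // => i _; rewrite (linear_at0 (cl i)) scale0r.
  have sc : c k @ (0 : E) --> (0 : R).
    by have := cc k 0; rewrite /continuous_at (linear_at0 (cl k)).
  move=> [[A B] [/= /yc A0 /sc B0] AB].
  have A1 : \forall h \near (0 : E), A (x + \sum_(i < k) c i h *: e i) by [].
  have B1 : \forall h \near (0 : E), B (c k h) by [].
  apply: filterS3 A1 B1 (IH _ e2) => h Ah Bh H1.
  have /= H2 := AB (_, _) (conj Ah Bh).
  rewrite !big_ord_recr /= addrA.
  set y := x + _ in H1 H2 *; set S := \sum_(i < k) _ in H1 *.
  have -> : f (y + c k h *: e k) - f x - (S + c k h *: 'D_(e k) f x) =
     (f y - f x - S) + (f (y + c k h *: e k) - f y - c k h *: 'D_(e k) f x).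
    exact: telescope_increment.
  rewrite (le_trans (ler_normD _ _)) // [in leRHS](splitr eps') mulrDl.
  rewrite lerD // (le_trans H2) //.
  by rewrite -mulrA ler_pM2l // mulrC ler_pdivrMr // mulrC.
have := claim m eps eps0; apply: filterS => h.
by rewrite -hE.
Qed.

End SmoothOpen.

Section Frames.
Context {R : realType}.
Implicit Types E F G : normedModType R.

Lemma Ck_sum n E F (U : set E) m (f : nat -> E -> F) : open U ->
  (forall i, Ck n U (f i)) -> Ck n U (fun x => \sum_(i < m) f i x).
Proof.
move=> Uo fC; elim: m => [|m IH].
  rewrite (_ : (fun x => _) = fun=> 0); first exact: Ck_cst.
  by apply/funext => x; rewrite big_ord0.
rewrite (_ : (fun x => _) = fun x => \sum_(i < m) f i x + f m x).
  exact: Ck_add.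
by apply/funext => x; rewrite big_ord_recr.
Qed.

(** The tangent map of f is a combination of coordinate forms and of the partial
    derivatives of f, to which the induction hypothesis applies. *)
Lemma smooth_open_smooth E F m (c : nat -> E -> R) (e : nat -> E) (U : set E) (f : E -> F) :
  frame m c e -> open U -> smooth_open U f -> smooth U f.
Proof.
move=> fr Uo fS n; elim: n f fS => [|n IH] f fS.
  by move=> x Ux; have [] := fS [::] x Ux.
have dS v : smooth_open U ('D_v f).
  by move=> vs p Up; have := fS (rcons vs v) p Up; rewrite /iter_derive foldr_rcons.
apply: (@CkS _ _ _ _ _ _ (fun x h => \sum_(i < m) c i h *: 'D_(e i) f x)) => //.
  move=> x Ux; apply: (frame_is_diff fr Uo Ux).
    by move=> i y Uy; have [_] := fS [::] y Uy; exact.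
  by move=> i; have [] := fS [:: e i] x Ux.
have U'o := @open_setX_setT _ E _ Uo.
have [cl cc _] := fr.
have C1 : Ck n (U `*` [set: E]) fst by exact: Ck_fst.
have C2 : Ck n (U `*` [set: E]) snd by exact: Ck_snd.
have UV (p : E * E) : (U `*` [set: E]) p -> U p.1 by case.
apply: Ck_pair => //.
  exact: (Ck_comp U'o UV C1 (IH _ fS)).
apply: (@Ck_sum _ _ _ _ _ (fun i (p : E * E) => c i p.2 *: 'D_(e i) f p.1)) => // i.
apply: Ck_scale => //; first exact: (Ck_linear_comp U'o (cl i) (cc i) C2).
exact: (Ck_comp U'o UV C1 (IH _ (dS _))).
Qed.

Definition spacetime_coord (i : nat) (p : 'rV[R]_2 * R) : R :=
  if i is 0 then p.1 0 0 else if i is 1 then p.1 0 1 else p.2.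

Definition spacetime_vec (i : nat) : 'rV[R]_2 * R :=
  if i is 0 then ('e_0, 0) else if i is 1 then ('e_1, 0) else (0, 1).

Lemma rV2E (z : 'rV[R]_2) : z = z 0 0 *: 'e_0 + z 0 1 *: 'e_1.
Proof.
rewrite {1}(row_sum_delta z) big_ord_recl big_ord1.
by have -> : lift ord0 ord0 = 1 :> 'I_2 by exact: val_inj.
Qed.

Lemma frame_spacetime : frame 3 spacetime_coord spacetime_vec.
Proof.
split.
- case=> [|[|i]] k p q /=; by rewrite ?mxE.
- have cc j : continuous (fun p : 'rV[R]_2 * R => p.1 0 j).
    move=> p; apply: (@continuous_comp _ _ _ fst (fun z : 'rV[R]_2 => z 0 j)).
      exact: cvg_fst.
    exact: coord_continuous.
  case=> [|[|i]]; [exact: (cc 0)|exact: (cc 1)|].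
  by move=> p; exact: cvg_snd.
- move=> [z t]; rewrite !big_ord_recl big_ord0 /= addr0.
  apply/pair_equal_spec; split => /=.
    by rewrite {1}[z]rV2E /= scaler0 addr0.
  by rewrite !scaler0 !add0r [_ *: _]mulr1.
Qed.

(** On a square with sides h u and h v, the second difference of f equals
    h^2 D_u D_v f + o(h^2), by two applications of the mean value inequality. *)
Lemma second_difference E F (U : set E) (f : E -> F) (x u v : E) :
  open U -> Ck 2 U f -> U x -> forall eps, 0 < eps ->
  \forall h \near (0 : R)^'+,
    `|f (x + h *: u + h *: v) - f (x + h *: v) - (f (x + h *: u) - f x)
      - (h * h) *: 'D_u ('D_v f) x| <= eps * (h * h).
Proof.
move=> Uo fC Ux eps eps0.
have Dv := Ck_derive v Uo fC.
have Duv := Ck_derive u Uo Dv.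
have d1 y w : U y -> derivable f y w.
  by move=> Uy; apply: diff_derivable; exact: fC.1.
have d2 y w : U y -> derivable ('D_v f) y w.
  by move=> Uy; apply: diff_derivable; exact: Dv.1.
have : \forall z \near x, U z /\ `|'D_u ('D_v f) x - 'D_u ('D_v f) z| <= eps.
  apply: filterI; first exact: open_nbhs_nbhs.
  by have /cvgrPdist_le := Duv x Ux; apply.
move=> /nbhs_normP[d /= d0 Hd].
have K0 : 0 < `|u| + `|v| + 1 by rewrite ltr_wpDl // addr_ge0.
near=> h.
have h0 : 0 < h by near: h; exact: nbhs_right_gt.
have hd : h * (`|u| + `|v| + 1) < d.
  rewrite -ltr_pdivlMr //; near: h; apply: nbhs_right_lt; exact: divr_gt0.
have Hz r s : 0 <= r <= h -> 0 <= s <= h -> U (x + s *: v + r *: u) /\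
    `|'D_u ('D_v f) x - 'D_u ('D_v f) (x + s *: v + r *: u)| <= eps.
  move=> /andP[r0 rh] /andP[s0 sh]; apply: Hd => /=.
  rewrite -addrA opprD addrA subrr sub0r normrN.
  rewrite (le_lt_trans (ler_normD _ _)) // !normrZ !ger0_norm //.
  apply: le_lt_trans hd; rewrite mulrDr mulr1 mulrDr.
  rewrite (le_trans (lerD (ler_wpM2r (normr_ge0 _) sh) (ler_wpM2r (normr_ge0 _) rh))) //.
  by rewrite addrC lerDl ltW.
have h01 : 0 <= (0 : R) <= h by apply/andP; split; [exact: lexx|exact: ltW].
have hh : 0 <= h <= h by apply/andP; split; [exact: ltW|exact: lexx].
have step s : 0 <= s <= h ->
    `|'D_v f (x + h *: u + s *: v) - 'D_v f (x + s *: v)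
      - h *: 'D_u ('D_v f) x| <= eps * h.
  move=> s0h.
  have := @mean_value_inequality _ _
    (fun r => 'D_v f (x + s *: v + r *: u) - r *: 'D_u ('D_v f) x)
    (fun r => 'D_u ('D_v f) (x + s *: v + r *: u) - 'D_u ('D_v f) x)
    (fun r => eps * r) (fun=> eps) 0 h (ltW h0).
  rewrite !scale0r addr0 subr0 mulr0 subr0 addrAC [x + _ + h *: u]addrAC; apply.
  - move=> r r0h; apply: is_deriveB; last exact: is_derive_scalel.
    by have [Ur _] := Hz _ _ r0h s0h; exact: (@is_derive_line _ _ _ ('D_v f) _ _ _ _ (derivableP (d2 _ u Ur))).
  - by move=> r _; apply: is_derive_eq; rewrite /GRing.scale /= mulr1.
  - by move=> r r0h; rewrite distrC; have [] := Hz _ _ r0h s0h.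
have := @mean_value_inequality _ _
  (fun s => f (x + h *: u + s *: v) - f (x + s *: v)
     - s *: (h *: 'D_u ('D_v f) x))
  (fun s => 'D_v f (x + h *: u + s *: v) - 'D_v f (x + s *: v)
      - h *: 'D_u ('D_v f) x)
  (fun s => (eps * h) * s) (fun=> eps * h) 0 h (ltW h0).
rewrite !scale0r !addr0 subr0 mulr0 subr0 scalerA addrAC mulrA; apply.
- move=> s s0h; apply: is_deriveB; last exact: is_derive_scalel.
  have [U1 _] := Hz _ _ hh s0h; rewrite addrAC in U1.
  have [U2 _] := Hz _ _ h01 s0h; rewrite scale0r addr0 in U2.
  apply: is_deriveB; first exact: (is_derive_line (derivableP (d1 _ v U1))).
  exact: (is_derive_line (derivableP (d1 _ v U2))).
- by move=> s _; apply: is_derive_eq; rewrite /GRing.scale /= mulr1.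
- by move=> s; exact: step.
Unshelve. all: by end_near. Qed.

(** The second difference is symmetric in the two directions. *)
Lemma derive_comm E F (U : set E) (f : E -> F) (x u v : E) :
  open U -> Ck 2 U f -> U x -> 'D_u ('D_v f) x = 'D_v ('D_u f) x.
Proof.
move=> Uo fC Ux.
have := second_difference u v Uo fC Ux; have := second_difference v u Uo fC Ux.
generalize ('D_u ('D_v f) x), ('D_v ('D_u f) x) => a b HB HA.
apply/eqP; rewrite -subr_eq0 -normr_le0.
apply/ler_addgt0Pr => e e0; rewrite add0r.
have e2 : 0 < e / 2 by rewrite divr_gt0.
have nA := HA _ e2; have nB := HB _ e2.
near (0 : R)^'+ => h.
have h0 : 0 < h by near: h; exact: nbhs_right_gt.
have hh : 0 < h * h by rewrite mulr_gt0.
have : `|f (x + h *: u + h *: v) - f (x + h *: v) - (f (x + h *: u) - f x)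
      - (h * h) *: a| <= e / 2 * (h * h) by near: h.
have : `|f (x + h *: v + h *: u) - f (x + h *: u) - (f (x + h *: v) - f x)
      - (h * h) *: b| <= e / 2 * (h * h) by near: h.
rewrite [x + h *: v + h *: u]addrAC.
set D1 := f _ - _ - (_ - _); set D2 := f _ - _ - (_ - _) => H1 H2.
have D12 : D1 = D2.
  rewrite /D1 /D2 !opprB !addrA [LHS]addrAC [RHS]addrAC.
  by rewrite [X in X + _ = _]addrAC.
have dAB : (h * h) *: (a - b) = (D1 - (h * h) *: b) - (D2 - (h * h) *: a).
  by rewrite D12 opprB [RHS]addrC addrA subrK scalerBr.
rewrite -(ler_pM2l hh) -[X in X * _](gtr0_norm hh) -normrZ dAB.
rewrite (le_trans (ler_normB _ _)) // (le_trans (lerD H1 H2)) //.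
by rewrite -mulrDl -splitr mulrC.
Unshelve. all: by end_near. Qed.

End Frames.

(** * Spaces in which differential equations can be solved *)

Section PicardSpaces.
Context {R : realType}.
Implicit Types E F G : normedModType R.

Lemma geometric_cvg (E : completeNormedModType R) (u : nat -> E) (C : R) :
  (forall n, `|u n.+1 - u n| <= C / 2 ^+ n) ->
  exists l, forall n, `|u n - l| <= 2 * C / 2 ^+ n.
Proof.
move=> uC.
have C0 : 0 <= C.
  by have := uC 0%N; rewrite expr0 divr1; apply: le_trans.
have tele n k : `|u (n + k)%N - u n| <= 2 * C / 2 ^+ n - 2 * C / 2 ^+ (n + k).
  elim: k => [|k IH]; first by rewrite addn0 !subrr normr0.
  rewrite addnS -(subrKA (u (n + k)%N)).
  rewrite (le_trans (ler_normD _ _)) // (le_trans (lerD (uC _) IH)) //.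
  have -> : C / 2 ^+ (n + k) = 2 * C / 2 ^+ (n + k) - 2 * C / 2 ^+ (n + k).+1.
    by rewrite exprS; field; rewrite expf_neq0.
  by lra.
have tele' n k : `|u (n + k)%N - u n| <= 2 * C / 2 ^+ n.
  by rewrite (le_trans (tele n k)) // gerBl divr_ge0 ?mulr_ge0 ?exprn_ge0.
have small := geometric_small C0.
have : cvgn u.
  apply/cauchy_cvgP/cauchy_exP => e e0.
  have [n nP] := small e e0.
  exists (u n); exists n => // m /= nm; rewrite -ball_normE /= distrC.
  by have := tele' n (m - n)%N; rewrite subnKC // => /le_lt_trans; apply.
move=> /cvg_ex[l /cvgrPdist_lt ul]; exists l => n.
apply/ler_addgt0Pr => e e0; have [m _ Hm] := ul e e0.
have := Hm _ (leq_addl n m); have := tele' n m => /= H1 H2.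
rewrite -(subrKA (u (n + m)%N)) (le_trans (ler_normD _ _)) //.
by rewrite [`|u n - _|]distrC [`|_ - l|]distrC lerD // ltW.
Qed.

Lemma is_derive_linear_comp E F G (f : E -> F) (l : F -> G) x v d :
  linear l -> continuous l ->
  is_derive x v f d -> is_derive x v (fun y => l (f y)) (l d).
Proof.
move=> ll lc /is_derive_epsP H; apply/is_derive_epsP => e e0.
have [M M0 HM] := linear_bound ll lc.
apply: filterS (H _ (divr_gt0 e0 M0)) => h Hh.
have lB y z : l (y - z) = l y - l z.
  by have := ll (-1) z y; rewrite !scaleN1r ![- _ + _]addrC.
have lZ k y : l (k *: y) = k *: l y.
  by have := ll k y 0; rewrite (linear_at0 ll) !addr0.
rewrite -lZ -!lB (le_trans (HM _)) // -ler_pdivlMl //.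
by rewrite (le_trans Hh) // mulrAC mulrC mulrA.
Qed.

Lemma is_derive_pair E F G (f : E -> F) (g : E -> G) x v a b :
  is_derive x v f a -> is_derive x v g b ->
  is_derive x v (fun y => (f y, g y)) (a, b).
Proof.
move=> /is_derive_epsP Hf /is_derive_epsP Hg; apply/is_derive_epsP => e e0.
apply: filterS2 (Hf e e0) (Hg e e0) => h H1 H2.
by rewrite prod_normE /= ge_max H1 H2.
Qed.

Lemma picard_space_real : picard_space R.
Proof.
split; first exact: geometric_cvg.
move=> f fc.
have I12 : (@lebesgue_measure R).-integrable `[-1, 2] (EFin \o f).
  apply: continuous_compact_integrable; first exact: segment_compact.
  by apply: continuous_subspaceT.
exists (fun x => \int[lebesgue_measure]_(t in `[-1, x]) f t)%R => s /andP[s0 s1].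
have s2 : s < 2 by lra.
have s_1 : -1 < s by lra.
have [d e] := continuous_FTC1_closed s2 I12 s_1 (fc s).
by apply: DeriveDef; [exact: d|rewrite -derive1E; exact: e].
Qed.

Lemma picard_space_prod E F :
  picard_space E -> picard_space F -> picard_space (E * F)%type.
Proof.
move=> [cE pE] [cF pF]; split.
  move=> u C uC.
  have [|a Ha] := cE (fun n => (u n).1) C.
    by move=> n; apply: le_trans (uC n); rewrite prod_normE le_max lexx.
  have [|b Hb] := cF (fun n => (u n).2) C.
    by move=> n; apply: le_trans (uC n); rewrite prod_normE le_max lexx orbT.
  by exists (a, b) => n; rewrite prod_normE ge_max Ha Hb.
move=> f fc.
have [|F1 H1] := pE (fst \o f).
  by move=> s; apply: continuous_comp; [exact: fc|exact: cvg_fst].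
have [|F2 H2] := pF (snd \o f).
  by move=> s; apply: continuous_comp; [exact: fc|exact: cvg_snd].
exists (fun s => (F1 s, F2 s)) => s s01; rewrite [f s]surjective_pairing.
exact: is_derive_pair (H1 _ s01) (H2 _ s01).
Qed.

Lemma norm_coord_le (z : 'rV[R]_2) (j : 'I_2) : `|z 0 j| <= `|z|.
Proof.
rewrite [leRHS]/Num.norm /= mx_normrE.
exact: (le_bigmax _ (fun ij : 'I_1 * 'I_2 => `|z ij.1 ij.2|) (0, j)).
Qed.

Lemma plane_norm_le (z : 'rV[R]_2) (M : R) :
  `|z 0 0| <= M -> `|z 0 1| <= M -> `|z| <= M.
Proof.
move=> z0 z1; rewrite [leLHS]/Num.norm /= mx_normrE; apply: bigmax_le.
  by apply: le_trans z0.
move=> [i j] _ /=; rewrite ord1; case: j => [[|[|//]] jP].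
  by rewrite (_ : Ordinal jP = 0) //; apply: val_inj.
by rewrite (_ : Ordinal jP = 1) //; apply: val_inj.
Qed.

Lemma picard_space_plane : picard_space 'rV[R]_2.
Proof.
split.
  move=> u C uC.
  have cC (j : 'I_2) n : `|u n.+1 0 j - u n 0 j| <= C / 2 ^+ n.
    apply: le_trans (uC n).
    by have := norm_coord_le (u n.+1 - u n) j; rewrite !mxE.
  have [a Ha] := geometric_cvg (cC 0).
  have [b Hb] := geometric_cvg (cC 1).
  exists (a *: 'e_0 + b *: 'e_1) => n.
  by apply: plane_norm_le; rewrite !mxE /= !(mulr1, mulr0, addr0, add0r).
move=> f fc.
have [_ pR] := picard_space_real.
have [|F0 H0] := pR (fun s => f s 0 0).
  move=> s; apply: (@continuous_comp _ _ _ f (fun z : 'rV[R]_2 => z 0 0)).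
    exact: fc.
  exact: coord_continuous.
have [|F1 H1] := pR (fun s => f s 0 1).
  move=> s; apply: (@continuous_comp _ _ _ f (fun z : 'rV[R]_2 => z 0 1)).
    exact: fc.
  exact: coord_continuous.
exists (fun s => F0 s *: 'e_0 + F1 s *: 'e_1) => s s01; rewrite [f s]rV2E.
have lin (a : 'rV[R]_2) : linear (fun k : R^o => k *: a).
  by move=> k x y; rewrite scalerDl scalerA.
apply: is_deriveD.
  apply: (@is_derive_linear_comp _ _ _ F0 (fun k : R => k *: 'e_0) s 1 _ _ _ (H0 _ s01)).
    exact: lin.
  exact: scalel_continuous.
apply: (@is_derive_linear_comp _ _ _ F1 (fun k : R => k *: 'e_1) s 1 _ _ _ (H1 _ s01)).
    exact: lin.
  exact: scalel_continuous.
Qed.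

End PicardSpaces.

(** * Tubes around solution curves *)

Section Flow.
Context {R : realType}.
Implicit Types E F : normedModType R.

Lemma deriveZv E F (f : E -> F) x k v : differentiable f x ->
  'D_(k *: v) f x = k *: 'D_v f x.
Proof. by move=> df; rewrite !deriveE // linearZ. Qed.

(** Continuity of the tangent map at (x, 0) bounds f'(z) v for z near x and small
    v; the bound for all v follows by homogeneity. *)
Lemma Ck1_locally_bounded E F (U : set E) (f : E -> F) x : open U -> U x ->
  Ck 1 U f -> exists2 r, 0 < r & forall z, `|x - z| < r ->
    U z /\ forall v, `|'D_v f z| <= `|v| / r.
Proof.
move=> Uo Ux [df Tf].
have Tfx : {for (x, 0 : E), continuous (tangent f)} by apply: Tf.
have : \forall z \near x, U z by exact: open_nbhs_nbhs.
move=> /nbhs_normP[a /= a0 Ha].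
move/cvgrPdist_le : Tfx => /(_ 1 ltr01) /nbhs_normP[b /= b0 Hb].
pose r := Num.min a (b / 2).
have r0 : 0 < r by rewrite lt_min a0 divr_gt0.
exists r => // z xz.
have Uz : U z by apply: Ha => /=; rewrite (lt_le_trans xz) // ge_min lexx.
split => // v.
have [->|v0] := eqVneq v 0; first by rewrite derive0 !normr0 mul0r.
have nv : 0 < `|v| by rewrite normr_gt0.
pose k := r / `|v|.
have k0 : 0 < k by rewrite divr_gt0.
have rb : r < b.
  by rewrite (@le_lt_trans _ _ (b / 2)) ?ge_min ?lexx ?orbT // gtr_pMr // invf_lt1 // ltr1n.
have : `|tangent f (x, 0) - tangent f (z, k *: v)| <= 1.
  apply: Hb; rewrite /= prod_normE /= gt_max (lt_trans xz) //=.
  rewrite sub0r normrN normrZ gtr0_norm // /k divfK ?gt_eqF //.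
rewrite prod_normE ge_max => /andP[_]; rewrite /= derive0 sub0r normrN.
rewrite deriveZv; last exact: df.
by rewrite normrZ gtr0_norm // mulrC -ler_pdivlMr // div1r /k invf_div.
Qed.

Lemma locally_bounded_lipschitz E F (U : set E) (f : E -> F) x (r L : R) :
  Ck 1 U f ->
  (forall z, `|x - z| < r -> U z /\ forall v, `|'D_v f z| <= L * `|v|) ->
  forall y z, `|x - y| < r -> `|x - z| < r -> `|f z - f y| <= L * `|z - y|.
Proof.
move=> [df _] H y z xy xz.
have Hr (s : R) : 0 <= s <= 1 -> `|x - (y + s *: (z - y))| < r.
  move=> /andP[s0 s1].
  have -> : x - (y + s *: (z - y)) = (1 - s) *: (x - y) + s *: (x - z).
    rewrite scalerBl scale1r -[RHS]addrA -scalerN -scalerDr opprB subrKA.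
    by rewrite opprD addrA -scalerN opprB.
  rewrite (le_lt_trans (ler_normD _ _)) // !normrZ ger0_norm ?subr_ge0 //.
  rewrite ger0_norm //.
  have [->|sn1] := eqVneq s 1; first by rewrite subrr mul0r add0r mul1r.
  have s1' : 0 < 1 - s by rewrite subr_gt0 lt_neqAle sn1.
  apply: (@lt_le_trans _ _ ((1 - s) * r + s * r)); last by rewrite -mulrDl subrK mul1r.
  by rewrite ltr_leD // ?ltr_pM2l // ler_wpM2l // ltW.
have := @mean_value_inequality _ _ (fun s : R => f (y + s *: (z - y)))
  (fun s => 'D_(z - y) f (y + s *: (z - y)))
  (fun s => (L * `|z - y|) * s) (fun=> L * `|z - y|) 0 1 ler01.
rewrite scale1r scale0r addr0 mulr1 mulr0 subr0 [y + (z - y)]addrC subrK; apply.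
- move=> s /Hr/H[Us _]; apply: is_derive_line.
  by apply/derivableP/diff_derivable/df.
- by move=> s _; apply: is_derive_eq; rewrite /GRing.scale /= mulr1.
- by move=> s /Hr/H[_]; exact.
Qed.

(** The ball of radius r around x lies in U, and on it the derivative of G is
    bounded by 1/r and Lipschitz with constant 1/r. A single parameter r for
    the three bounds makes the condition monotone, hence suited to
    compactness arguments. *)
Definition tube E F (U : set E) (G : E -> F) (x : E) (r : R) :=
  forall z1 z2, `|x - z1| < r -> `|x - z2| < r ->
    U z1 /\ forall v, `|'D_v G z1| <= `|v| / r /\
      `|'D_v G z1 - 'D_v G z2| <= `|z1 - z2| * `|v| / r.

Lemma tube_shift E F (U : set E) (G : E -> F) (x y : E) (r q : R) :
  0 < q -> q <= r / 2 -> `|x - y| < r / 2 -> tube U G x r -> tube U G y q.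
Proof.
move=> q0 qr xy H z1 z2 yz1 yz2.
have r0 : 0 < r by rewrite -(@pmulr_lgt0 _ 2^-1) // (lt_le_trans q0).
have qr' : q <= r by rewrite (le_trans qr) // ler_pdivrMr // ler_peMr ?ltW // ltr1n.
have shift z : `|y - z| < q -> `|x - z| < r.
  move=> yz; rewrite -(subrKA y) (le_lt_trans (ler_normD _ _)) //.
  by rewrite [r]splitr ltrD // (lt_le_trans yz).
have [Uz1 Hz] := H z1 z2 (shift _ yz1) (shift _ yz2).
have ri : r^-1 <= q^-1 by rewrite lef_pV2.
split=> // v; have [H1 H2] := Hz v; split.
  by rewrite (le_trans H1) // ler_wpM2l.
by rewrite (le_trans H2) // ler_wpM2l // mulr_ge0.
Qed.

(** Apply the local bound to the tangent map of G at (x, 0): its Lipschitz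
    constant controls z |-> G'(z) v for small v. *)
Lemma tube_pt E F (U : set E) (G : E -> F) x : open U -> U x ->
  Ck 2 U G -> exists2 r, 0 < r & tube U G x r.
Proof.
move=> Uo Ux GC.
have [a a0 Ha] := Ck1_locally_bounded Uo Ux (CkS_Ck GC).
have U'o := @open_setX_setT _ E _ Uo.
have TC : Ck 1 (U `*` [set: E]) (tangent G) := GC.2.
have [b b0 Hb] := Ck1_locally_bounded U'o (conj Ux I : (U `*` [set: E]) (x, 0)) TC.
pose r1 := Num.min a b.
have r10 : 0 < r1 by rewrite lt_min a0.
pose r := Num.min r1 (b * b / 2).
have r0 : 0 < r by rewrite lt_min r10 divr_gt0 // mulr_gt0.
have ra : r <= a by rewrite /r /r1 !ge_min lexx.
have rb : r <= b by rewrite /r /r1 !ge_min lexx !orbT.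
have rbb : r <= b * b / 2 by rewrite /r ge_min lexx orbT.
exists r => // z1 z2 xz1 xz2.
have [Uz1 B1] := Ha _ (lt_le_trans xz1 ra).
have [Uz2 _] := Ha _ (lt_le_trans xz2 ra).
have dG z : U z -> differentiable G z by move=> /GC.1.
split=> // v; split.
  by rewrite (le_trans (B1 v)) // ler_wpM2l // lef_pV2 // posrE.
have [->|v0] := eqVneq v 0.
  by rewrite !derive0 subrr !normr0 mulr0 mul0r.
have nv : 0 < `|v| by rewrite normr_gt0.
pose k := b / 2 / `|v|.
have k0 : 0 < k by rewrite !divr_gt0.
have kv : `|k *: v| < b.
  rewrite normrZ gtr0_norm // /k divfK ?gt_eqF // ltr_pdivrMr //.
  by rewrite ltr_pMr // ltr1n.
have Hb' : forall z, `|((x, 0) : E * E) - z| < b ->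
   (U `*` [set: E]) z /\ forall v, `|'D_v (tangent G) z| <= b^-1 * `|v|.
  by move=> z /Hb[Uz Hz]; split=> // w; rewrite mulrC.
have near z : `|x - z| < r -> `|((x, 0) : E * E) - (z, k *: v)| < b.
  move=> xz; rewrite prod_normE /= gt_max (lt_le_trans xz rb) /=.
  by rewrite sub0r normrN.
have := locally_bounded_lipschitz TC Hb' (near _ xz2) (near _ xz1).
rewrite [X in X <= _]prod_normE ge_max => /andP[_] /=.
rewrite !deriveZv; [|exact: dG..].
rewrite -scalerBr normrZ gtr0_norm // prod_normE /= subrr normr0.
rewrite (max_l (normr_ge0 _)) -ler_pdivlMl // => /le_trans; apply.
have -> : k^-1 * (b^-1 * `|z1 - z2|) = `|z1 - z2| * `|v| / (b * b / 2).
  by rewrite /k; field; rewrite !gt_eqF.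
by rewrite ler_wpM2l ?mulr_ge0 // lef_pV2 // posrE divr_gt0 // mulr_gt0.
Qed.

(** By compactness of [0, 1], one radius serves for the whole curve. *)
Lemma tube_segment E F (U : set E) (G : E -> F) (X : R -> E) : open U ->
  Ck 2 U G -> (forall s, 0 <= s <= 1 -> U (X s) /\ {for s, continuous X}) ->
  exists2 r, 0 < r & forall s, 0 <= s <= 1 -> tube U G (X s) r.
Proof.
move=> Uo GC XU.
have /compact_near_coveringP cov := @segment_compact R 0 1.
suff : \forall r \near (0 : R)^'+, `[0, 1] `<=` (fun s => tube U G (X s) r).
  move=> H; near (0 : R)^'+ => r; exists r.
    by near: r; exact: nbhs_right_gt.
  have Hr : `[0, 1] `<=` (fun s => tube U G (X s) r) by near: r; exact: H.
  by move=> s s01; apply: Hr; rewrite /= in_itv.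
apply: cov => s /=; rewrite in_itv /= => /XU[Us Xc].
have [r r0 Hr] := tube_pt Uo Us GC.
have r2 : 0 < r / 2 by rewrite divr_gt0.
have near_s : \forall t \near s, `|X s - X t| < r / 2.
  by move/cvgrPdist_lt : Xc; apply.
have near_r : \forall q \near (0 : R)^'+, 0 < q /\ q <= r / 2.
  near=> q; split; near: q; [exact: nbhs_right_gt|exact: nbhs_right_le].
exists ([set t | `|X s - X t| < r / 2], [set q | 0 < q /\ q <= r / 2]) => //.
move=> [t q] [/= ts [q0 qr]].
exact: tube_shift Hr.
Unshelve. all: by end_near. Qed.

End Flow.

Section FlowSmooth.
Context {R : realType}.
Implicit Types E F : normedModType R.

(** Bootstrap principle: if g <= q at any time before which g < r, and q < r, then
    g <= q throughout. Otherwise let m be the infimum of the times with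
    r <= g: then g(m) <= q, so g < r in a neighbourhood of m, contradicting the
    choice of m. *)
Lemma barrier (g : R -> R) (q r b : R) : q < r ->
  (forall s, 0 <= s <= b -> {for s, continuous g}) ->
  (forall t, 0 <= t <= b -> (forall s, 0 <= s < t -> g s < r) -> g t <= q) ->
  forall t, 0 <= t <= b -> g t <= q.
Proof.
move=> qr gc H t t0b; have Ht := H t t0b; apply: Ht => s /andP[s0 st].
rewrite ltNge; apply/negP => gsr.
have sb : s <= b by case/andP: t0b => _; apply/le_trans/ltW.
pose S := [set u | 0 <= u <= b /\ r <= g u].
have Sinf : has_inf S.
  by split; [exists s; rewrite /S /= s0 sb|exists 0 => u [/andP[]]].
pose m := inf S.
have m0 : 0 <= m by apply: lb_le_inf; [exact: Sinf.1|move=> u [/andP[]]].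
have mb : m <= b by apply: (le_trans _ sb); apply: (ge_inf Sinf.2); rewrite /S /= s0 sb.
have gm : g m <= q.
  apply: H; rewrite ?m0 // => u /andP[u0 um].
  rewrite ltNge; apply/negP => gur.
  have : m <= u by apply: (ge_inf Sinf.2); rewrite /S /= u0 (le_trans (ltW um) mb).
  by rewrite leNgt um.
have mc : {for m, continuous g} by apply: gc; rewrite m0.
have /nbhs_normP[d /= d0 Hd] : \forall u \near m, g u < r.
  by move/cvgr_lt : mc; apply; exact: le_lt_trans qr.
have [u [/andP[u0 ub] gu] um] := inf_adherent d0 Sinf.
have mu : m <= u by apply: (ge_inf Sinf.2); rewrite /S /= u0 ub.
have : g u < r.
  apply: Hd => /=; rewrite distrC ger0_norm ?subr_ge0 //.
  by rewrite ltrBlDl.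
by rewrite ltNge gu.
Qed.

Definition solution_family E (U : set E) (G : E -> E) (P : set E)
    (X : E -> R -> E) :=
  forall x, P x -> X x 0 = x /\ forall s : R, 0 <= s <= 1 ->
    U (X x s) /\ is_derive s 1 (X x) (G (X x s)).

(** As long as two solutions stay at distance less than r, the tube makes their
    difference subject to Gronwall's inequality, which keeps this distance
    below C |h| < r; hence they never leave the tube. *)
Lemma solution_stable E (U : set E) (G : E -> E) (P : set E)
    (X : E -> R -> E) (x : E) (r : R) : 0 < r ->
  Ck 1 U G -> solution_family U G P X -> P x ->
  (forall s : R, 0 <= s <= 1 -> tube U G (X x s) r) ->
  exists2 C, 0 < C & \forall h \near (0 : E), P (x + h) ->
    forall s : R, 0 <= s <= 1 -> `|X x s - X (x + h) s| < r /\
      `|X (x + h) s - X x s| <= C * `|h|.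
Proof.
move=> r0 GC XP Px tb.
have L0 : 0 <= r^-1 by rewrite invr_ge0 ltW.
pose C := 2 * expR (2 * r^-1).
have C0 : 0 < C by rewrite mulr_gt0 ?expR_gt0.
exists C => //.
have rC : 0 < r / C / 2 by rewrite !divr_gt0.
apply: filterS (nbhs0_lt rC) => h hr Ph s s01.
have [X0 XD] := XP _ Px; have [Y0 YD] := XP _ Ph.
pose y t := X (x + h) t - X x t.
have yD (t : R) : 0 <= t <= 1 -> is_derive t 1 y (G (X (x + h) t) - G (X x t)).
  by move=> t01; apply: is_deriveB; [exact: (YD _ t01).2|exact: (XD _ t01).2].
have Chr : C * `|h| < r.
  have := hr; rewrite ltr_pdivlMr // ltr_pdivlMr // mulrC => /le_lt_trans; apply.
  by rewrite ler_wpM2l ?(ltW C0) // ler_peMr // ler1n.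
have bnd : forall t : R, 0 <= t <= 1 -> `|y t| <= C * `|h|.
  apply: (barrier Chr) => t t01.
    by apply: cvg_norm; exact: derive_continuous (yD _ t01).
  move=> yr; have /andP[t0 t1] := t01.
  have sub (u : R) : 0 <= u < t -> `|y u| <= C * `|h|.
    move=> /andP[u0 ut].
    have u1 : u <= 1 by rewrite (le_trans (ltW ut)).
    have H := @gronwall _ _ y (fun t => G (X (x + h) t) - G (X x t)) r^-1 0
      `|h| u L0 (lexx _) u0.
    have : `|y u| <= 2 * (`|h| + 0 * u) * expR (2 * r^-1 * u).
      apply: H; rewrite ?u0 ?lexx //.
      - by move=> v /andP[v0 vu]; apply: yD; rewrite v0 (le_trans vu).
      - move=> v /andP[v0 vu]; rewrite addr0.
        have v01 : 0 <= v <= 1 by rewrite v0 (le_trans vu).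
        have Hv z : `|X x v - z| < r -> U z /\ forall w, `|'D_w G z| <= r^-1 * `|w|.
          move=> xz; have [Uz Hz] := tb _ v01 z z xz xz.
          by split=> // w; rewrite mulrC; have [] := Hz w.
        apply: (locally_bounded_lipschitz GC Hv); first by rewrite subrr normr0.
        by rewrite distrC; apply: yr; rewrite v0 (le_lt_trans vu).
      - by rewrite /y X0 Y0 addrC addKr.
    rewrite mul0r addr0 => /le_trans; apply.
    rewrite mulrAC ler_wpM2r // /C ler_wpM2l // ler_expR ler_piMr //.
    by rewrite mulr_ge0.
  have [t_eq0|tn0] := eqVneq t 0.
    rewrite t_eq0 /y X0 Y0 addrC addKr ler_peMl // /C.
    have E1 : 1 <= expR (2 * r^-1) by rewrite -expR0 ler_expR mulr_ge0.
    by rewrite (le_trans E1) // ler_peMl ?expR_ge0 // ler1n.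
  have tgt0 : 0 < t by rewrite lt_neqAle eq_sym tn0.
  have yc : `|y u| @[u --> t] --> `|y t|.
    by apply: cvg_norm; exact: derive_continuous (yD _ t01).
  apply/ler_addgt0Pr => e e0.
  have yl : `|y u| @[u --> t^'-] --> `|y t| by exact: cvg_at_left_filter.
  near t^'- => u.
  have yu : `|y u| <= C * `|h|.
    apply: sub; apply/andP; split; near: u; last exact: nbhs_left_lt.
    exact: nbhs_left_ge.
  have : `| `|y t| - `|y u| | <= e by near: u; move/cvgrPdist_le: yl; exact.
  by rewrite ler_norml => /andP[_]; lra.
split; last exact: bnd.
by rewrite distrC (le_lt_trans (bnd _ s01)).
Unshelve. all: by end_near. Qed.

End FlowSmooth.

(** * Smooth dependence on initial data *)

Section FlowCk.
Context {R : realType}.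
Implicit Types E F : normedModType R.

Lemma near_translate E (P : set E) (x : E) : open P -> P x ->
  \forall h \near (0 : E), P (x + h).
Proof.
move=> Po Px.
have xc : (fun h => x + h) @ (0 : E) --> x.
  by rewrite -[X in _ --> X]addr0; apply: cvgD; [exact: cvg_cst|exact: cvg_id].
by apply: (xc P); exact: open_nbhs_nbhs.
Qed.

(** The linearisation w' = G'(X) w, along the curve X, of the equation of G. *)
Definition variational_solution E (G : E -> E) (X w : R -> E) :=
  forall s : R, 0 <= s <= 1 -> is_derive s 1 w ('D_(w s) G (X s)).

Lemma variational_exists E (U : set E) (G : E -> E) (X : R -> E) (r : R) :
  picard_space E -> 0 < r -> Ck 1 U G ->
  (forall s : R, 0 <= s <= 1 ->
     [/\ U (X s), {for s, continuous X} & tube U G (X s) r]) ->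
  forall v, exists w, w 0 = v /\ variational_solution G X w.
Proof.
move=> Ep r0 GC XP v.
pose B s w := 'D_w G (X (clamp 0 1 s)).
have L0 : 0 <= r^-1 by rewrite invr_ge0 ltW.
have c01 s := @clamp_bound R 0 1 s ler01.
have dG s : differentiable G (X (clamp 0 1 s)).
  by apply: GC.1; have [] := XP _ (c01 s).
have BL s y z : `|B s y - B s z| <= r^-1 * `|y - z|.
  rewrite /B -[X in _ - X]scale1r.
  have -> : 'D_y G (X (clamp 0 1 s)) - 1 *: 'D_z G (X (clamp 0 1 s)) =
     'D_(y - z) G (X (clamp 0 1 s)) by rewrite scale1r !deriveE // raddfB.
  have [_ _ tb] := XP _ (c01 s).
  set x := X _ in tb *.
  have xr : `|x - x| < r by rewrite subrr normr0.
  by have [_ /(_ (y - z))[+ _]] := tb _ _ xr xr; rewrite mulrC.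
have Bc (Y : R -> E) : continuous Y -> continuous (fun s => B s (Y s)).
  move=> Yc s.
  apply: (@continuous_comp _ _ _ (fun s => (X (clamp 0 1 s), Y s))
    (fun p => (tangent G p).2)).
    apply: continuous_pair; last exact: Yc.
    by apply: (@continuous_comp_clamp _ _ X 0 1 ler01) => t /XP[].
  apply: continuous_comp; last exact: cvg_snd.
  by apply: GC.2; split => //=; have [] := XP _ (c01 s).
have [w [w0 wD]] := picard v Ep L0 BL Bc.
exists w; split=> // s s01.
by have := wD _ s01; rewrite /B clamp_id.
Qed.

Lemma variational_bound E (U : set E) (G : E -> E) (X w : R -> E) (r : R) :
  0 < r -> (forall s : R, 0 <= s <= 1 -> tube U G (X s) r) ->
  variational_solution G X w ->
  forall s, 0 <= s <= 1 -> `|w s| <= 2 * expR (2 * r^-1) * `|w 0|.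
Proof.
move=> r0 tb wD s s01.
have L0 : 0 <= r^-1 by rewrite invr_ge0 ltW.
have := @gronwall _ _ w (fun s => 'D_(w s) G (X s)) r^-1 0 `|w 0| 1 L0
  (lexx _) ler01 wD _ (lexx _) _ s01.
rewrite mul0r addr0 => H; apply: le_trans (H _) _.
  move=> t /tb/(_ (X t) (X t)); rewrite subrr normr0 => /(_ r0 r0)[_ /(_ (w t))[+ _]].
  by rewrite addr0 mulrC.
rewrite mulrAC ler_wpM2r // ler_wpM2l // ler_expR ler_piMr ?mulr_ge0 //.
by case/andP: s01.
Qed.

Lemma variational_linear E (G : E -> E) (X w1 w2 : R -> E) (k : R) :
  (forall s : R, 0 <= s <= 1 -> differentiable G (X s)) ->
  variational_solution G X w1 -> variational_solution G X w2 ->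
  variational_solution G X (fun s => k *: w1 s + w2 s).
Proof.
move=> dG H1 H2 s s01; have dGs := dG _ s01.
rewrite deriveE // linearP -!deriveE //.
exact: (is_deriveD (is_deriveZ k (H1 _ s01)) (H2 _ s01)).
Qed.

(** Continuity is stability. The derivative of x |-> X x 1 in the direction v is
    the value at time 1 of the solution w of the linearised equation with
    w(0) = v: the error X(x + h) - X(x) - w solves the same linear equation up
    to a term quadratic in h. Now (X x, w) is a solution of the equation of
    the field tangent G from (x, v), so that the tangent map of
    x |-> X x 1 is itself a time 1 map, of a field that is again smooth, and
    the induction hypothesis applies to it. *)
Theorem flow_Ck n E (U : set E) (G : E -> E) (P : set E) (X : E -> R -> E) :
  picard_space E -> open U -> open P -> smooth U G ->
  solution_family U G P X -> Ck n P (fun x => X x 1).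
Proof.
elim: n E U G P X => [|n IH] E U G P X Ep Uo Po GS XP.
  move=> x Px.
  have [r r0 tb] : exists2 r, 0 < r & forall s, 0 <= s <= 1 -> tube U G (X x s) r.
    apply: tube_segment Uo (GS 2) _ => s s01.
    have [Us Xs] := (XP _ Px).2 _ s01; split=> //; exact: derive_continuous Xs.
  have [C C0 HC] := solution_stable r0 (GS 1%N) XP Px tb.
  have s01 : 0 <= (1 : R) <= 1 by rewrite ler01 lexx.
  apply/cvgrPdist_le => e e0.
  have eC : 0 < e / C by rewrite divr_gt0.
  have shP := near_translate Po Px.
  have H : \forall h \near (0 : E), `|X x 1 - X (x + h) 1| <= e.
    apply: filterS3 HC shP (nbhs0_le eC) => h H Ph he.
    have [_ H1] := H Ph _ s01.
    by rewrite distrC (le_trans H1) // mulrC -ler_pdivlMr.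
  have xc : (fun y => y - x) @ x --> (0 : E).
    rewrite -[X in _ --> X](subrr x); apply: cvgB; [exact: cvg_id|exact: cvg_cst].
  have Hy : \forall y \near x, `|X x 1 - X (x + (y - x)) 1| <= e.
    exact: (xc _ H).
  by apply: filterS Hy => y; rewrite [x + _]addrC subrK.
have tbP x : P x -> exists2 r, 0 < r &
    forall s, 0 <= s <= 1 -> tube U G (X x s) r.
  move=> Px; apply: tube_segment Uo (GS 2) _ => s s01.
  have [Us Xs] := (XP _ Px).2 _ s01; split=> //; exact: derive_continuous Xs.
have XU x (s : R) : P x -> 0 <= s <= 1 -> U (X x s).
  by move=> Px s01; have [_ /(_ _ s01)[]] := XP _ Px.
have XD x (s : R) : P x -> 0 <= s <= 1 -> is_derive s 1 (X x) (G (X x s)).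
  by move=> Px s01; have [_ /(_ _ s01)[]] := XP _ Px.
have dG x (s : R) : P x -> 0 <= s <= 1 -> differentiable G (X x s).
  by move=> Px s01; apply: (GS 1%N).1; exact: XU.
have /choice[W WP] : forall p : E * E, exists w, P p.1 ->
    w 0 = p.2 /\ variational_solution G (X p.1) w.
  move=> [x v]; have [Px|nPx] := pselect (P x); last by exists (fun=> 0).
  have [r r0 tb] := tbP _ Px.
  have [|w Hw] := @variational_exists _ U G (X x) r Ep r0 (GS 1%N) _ v.
    move=> s s01; split; [exact: XU|exact: derive_continuous (XD _ _ Px s01)|exact: tb].
  by exists w.
(* Solutions of the linearised equation are determined by their value at 0. *)
have WE x v w (s : R) : P x -> 0 <= s <= 1 -> w 0 = v ->
    variational_solution G (X x) w -> W (x, v) s = w s.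
  move=> Px s01 w0 wV; have [W0 WV] := WP (x, v) Px.
  have [r r0 tb] := tbP _ Px.
  have V := variational_linear (-1) (fun s => dG x s Px) wV WV.
  have := variational_bound r0 tb V s01.
  rewrite w0 W0 /= !scaleN1r addNr normr0 mulr0 normr_le0 addrC subr_eq0.
  by move/eqP.
have s01 : 0 <= (1 : R) <= 1 by rewrite ler01 lexx.
have diffX x : P x -> is_diff x (fun x => X x 1) (fun v => W (x, v) 1).
  move=> Px; have [r r0 tb] := tbP _ Px.
  have Wlin : linear (fun v => W (x, v) 1).
    move=> k a b.
    have [a0 aV] := WP (x, a) Px; have [b0 bV] := WP (x, b) Px.
    apply: (WE x (k *: a + b) (fun s => k *: W (x, a) s + W (x, b) s)) => //.
      by rewrite a0 b0.
    exact: variational_linear (fun s => dG x s Px) aV bV.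
  pose C' := 2 * expR (2 * r^-1).
  have C'0 : 0 < C' by rewrite mulr_gt0 ?expR_gt0.
  have Wbd v : `|W (x, v) 1| <= C' * `|v|.
    have [v0 vV] := WP (x, v) Px.
    by have := variational_bound r0 tb vV s01; rewrite v0.
  apply: is_diff_eps => //.
    move=> v; apply/cvgrPdist_le => e e0.
    have eC : 0 < e / C' by rewrite divr_gt0.
    have : \forall u \near v, `|v - u| <= e / C'.
      by have /cvgrPdist_le := @cvg_id _ (nbhs v); apply.
    apply: filterS => u vu.
    have -> : W (x, v) 1 - W (x, u) 1 = W (x, v - u) 1.
      have := Wlin (-1) u v; rewrite !scaleN1r [- u + v]addrC => ->.
      by rewrite addrC.
    by rewrite (le_trans (Wbd _)) // mulrC -ler_pdivlMr.
  move=> e e0.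
  have [C C0 HC] := solution_stable r0 (GS 1%N) XP Px tb.
  pose K := 2 * (r^-1 * (C * C)) * expR (2 * r^-1).
  have ri : 0 < r^-1 by rewrite invr_gt0.
  have K0 : 0 < K by rewrite !mulr_gt0 ?expR_gt0.
  have eK : 0 < e / K by rewrite divr_gt0.
  have shP := near_translate Po Px.
  apply: filterS3 HC shP (nbhs0_le eK) => h H Ph he.
  have [h0 hV] := WP (x, h) Px.
  pose k s := X (x + h) s - X x s.
  pose y s := X (x + h) s - X x s - W (x, h) s.
  pose y' s := G (X (x + h) s) - G (X x s) - 'D_(W (x, h) s) G (X x s).
  have yD (s : R) : 0 <= s <= 1 -> is_derive s 1 y (y' s).
    move=> ss; apply: is_deriveB; last exact: hV.
    by apply: is_deriveB; exact: XD.
  have kr (s : R) : 0 <= s <= 1 -> `|k s| < r /\ `|k s| <= C * `|h|.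
    by move=> ss; have [H1 H2] := H Ph _ ss; split=> //; rewrite distrC.
  (* First order expansion of G along the base solution, with an error
     bounded by the Lipschitz constant of G' in the tube. *)
  have taylor (s : R) : 0 <= s <= 1 ->
      `|G (X (x + h) s) - G (X x s) - 'D_(k s) G (X x s)| <=
      r^-1 * (C * C) * (`|h| * `|h|).
    move=> ss; set z := X x s.
    have [kr1 kr2] := kr _ ss.
    have zk : X (x + h) s = z + k s by rewrite /k /z [RHS]addrC subrK.
    rewrite zk.
    have bnd (t : R) : 0 <= t <= 1 -> U (z + t *: k s) /\
        `|'D_(k s) G (z + t *: k s) - 'D_(k s) G z| <= r^-1 * (`|k s| * `|k s|).
      move=> /andP[t0 t1].
      have tk : `|t *: k s| <= `|k s| by rewrite normrZ ger0_norm // ler_piMl.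
      have zz : `|z - (z + t *: k s)| < r.
        by rewrite opprD addrA subrr sub0r normrN (le_lt_trans tk).
      have zr : `|z - z| < r by rewrite subrr normr0.
      have [Ut /(_ (k s))[_ H2]] := tb _ ss _ _ zz zr; split=> //.
      rewrite (le_trans H2) // addrAC subrr add0r mulrC ler_wpM2l ?(ltW ri) //.
      by rewrite ler_wpM2r.
    have := @mean_value_inequality _ _
      (fun t : R => G (z + t *: k s) - t *: 'D_(k s) G z)
      (fun t => 'D_(k s) G (z + t *: k s) - 'D_(k s) G z)
      (fun t => (r^-1 * (`|k s| * `|k s|)) * t) (fun=> r^-1 * (`|k s| * `|k s|))
      0 1 ler01.
    rewrite !scale1r !scale0r addr0 subr0 mulr1 mulr0 subr0 addrAC => MV.
    apply: le_trans (MV _ _ _) _.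
    - move=> t /bnd[Ut _]; apply: is_deriveB; last exact: is_derive_scalel.
      by apply: is_derive_line; apply/derivableP/diff_derivable/(GS 1%N).1.
    - by move=> t _; apply: is_derive_eq; rewrite /GRing.scale /= mulr1.
    - by move=> t /bnd[].
    - by rewrite -mulrA ler_wpM2l ?(ltW ri) // mulrACA ler_pM.
  have y'le (s : R) : 0 <= s <= 1 ->
      `|y' s| <= r^-1 * `|y s| + r^-1 * (C * C) * (`|h| * `|h|).
    move=> ss.
    have -> : y' s = 'D_(y s) G (X x s) +
        (G (X (x + h) s) - G (X x s) - 'D_(k s) G (X x s)).
      have -> : 'D_(y s) G (X x s) = 'D_(k s) G (X x s) - 'D_(W (x, h) s) G (X x s).
        by have dGs := dG _ _ Px ss; rewrite !deriveE // -raddfB.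
      by rewrite /y' [RHS]addrC !addrA subrK.
    rewrite (le_trans (ler_normD _ _)) // lerD ?taylor //.
    have zr : `|X x s - X x s| < r by rewrite subrr normr0.
    have [_ /(_ (y s))[+ _]] := tb _ ss _ _ zr zr.
    by rewrite mulrC.
  have e'0 : 0 <= r^-1 * (C * C) * (`|h| * `|h|).
    by rewrite !mulr_ge0 // ltW.
  have y0 : `|y 0| <= 0.
    have [Xx0 _] := XP _ Px; have [Xh0 _] := XP _ Ph.
    by rewrite /y h0 Xx0 Xh0 [x + h]addrC addrK subrr normr0.
  have := gronwall (ltW ri) e'0 ler01 yD y'le y0 s01.
  rewrite add0r !mulr1 => /le_trans; apply.
  have -> : 2 * (r^-1 * (C * C) * (`|h| * `|h|)) * expR (2 * r^-1) =
     K * `|h| * `|h| by rewrite /K; ring.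
  by rewrite ler_wpM2r // mulrC -ler_pdivlMr.
apply: (CkS Po diffX).
have P'o := @open_setX_setT _ E _ Po.
have U'o := @open_setX_setT _ E _ Uo.
have GS' : smooth (U `*` [set: E]) (tangent G) by move=> m; exact: (GS m.+1).2.
apply: (IH _ (U `*` [set: E]) (tangent G) (P `*` [set: E])
   (fun p s => (X p.1 s, W (p.1, p.2) s))) => //.
  exact: picard_space_prod.
move=> [x v] [/= Px _]; have [W0 WV] := WP (x, v) Px; split.
  by rewrite W0 (XP _ Px).1.
move=> s ss; split; first by split => //=; exact: XU.
exact: is_derive_pair (XD _ _ Px ss) (WV _ ss).
Qed.

End FlowCk.

(** * Local flows of smooth vector fields *)

Section LocalFlow.
Context {R : realType}.
Implicit Types E F : normedModType R.

(** Radial retraction onto the closed ball of radius a around p. *)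
Definition retract E (p : E) (a : R) (x : E) : E :=
  p + (Num.max 1 (`|x - p| / a))^-1 *: (x - p).

Lemma retract_in E (p : E) (a : R) x : 0 < a -> `|p - retract p a x| <= a.
Proof.
move=> a0; rewrite /retract opprD addrA subrr sub0r normrN normrZ.
have m1 : 1 <= Num.max 1 (`|x - p| / a) by rewrite le_max lexx.
have m0 : 0 < Num.max 1 (`|x - p| / a) by exact: lt_le_trans m1.
rewrite ger0_norm ?invr_ge0 ?(ltW m0) // mulrC ler_pdivrMr //.
by rewrite mulrC -ler_pdivrMr // le_max lexx orbT.
Qed.

Lemma retract_id E (p : E) (a : R) x : 0 < a -> `|p - x| <= a ->
  retract p a x = x.
Proof.
move=> a0 px; rewrite /retract max_l ?invr1 ?scale1r ?[p + _]addrC ?subrK //.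
by rewrite ler_pdivrMr // mul1r distrC.
Qed.

Lemma max1_lipschitz (b c : R) : `|Num.max 1 b - Num.max 1 c| <= `|b - c|.
Proof.
have H : - `|b - c| <= b - c <= `|b - c| by rewrite -ler_norml.
have H0 := normr_ge0 (b - c).
by rewrite ler_norml; case: (leP 1 b); case: (leP 1 c) => *; lra.
Qed.

Lemma radial_lipschitz E (a : R) (u v : E) : 0 < a ->
  `|(Num.max 1 (`|u| / a))^-1 *: u - (Num.max 1 (`|v| / a))^-1 *: v|
    <= 2 * `|u - v|.
Proof.
move=> a0.
have nm := max1_lipschitz (`|v| / a) (`|u| / a).
set m := Num.max 1 (`|u| / a) in nm *; set n := Num.max 1 (`|v| / a) in nm *.
have m1 : 1 <= m by rewrite le_max lexx.
have n1 : 1 <= n by rewrite le_max lexx.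
have m0 : 0 < m by exact: lt_le_trans m1.
have n0 : 0 < n by exact: lt_le_trans n1.
(* Change the vector first, then the scaling factor. *)
have -> : m^-1 *: u - n^-1 *: v =
    m^-1 *: (u - v) + ((n - m) / m / n) *: v.
  have -> : (n - m) / m / n = m^-1 - n^-1 by field; rewrite !gt_eqF.
  by rewrite scalerBr scalerBl addrA subrK.
have va : `|v| / n <= a.
  by rewrite ler_pdivrMr // mulrC -ler_pdivrMr // le_max lexx orbT.
have {}nm : `|n - m| <= `|u - v| / a.
  rewrite (le_trans nm) // -mulrBl normrM [`|a^-1|]gtr0_norm ?invr_gt0 //.
  by rewrite ler_pM2r ?invr_gt0 // distrC ler_dist_dist.
rewrite (le_trans (ler_normD _ _)) // !normrZ ?normrM !normfV.
rewrite (gtr0_norm m0) (gtr0_norm n0) (_ : 2 * `|u - v| = `|u - v| + `|u - v|); last by ring.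
rewrite lerD //.
  by rewrite ler_piMl // invf_le1.
have -> : `|n - m| / m / n * `|v| = `|n - m| * m^-1 * (`|v| / n) by ring.
apply: (@le_trans _ _ (`|u - v| / a * 1 * a)); last first.
  by rewrite mulr1 divfK ?gt_eqF.
rewrite ler_pM ?mulr_ge0 ?divr_ge0 ?invr_ge0 ?(ltW m0) ?(ltW n0) //.
by rewrite ler_pM ?invr_ge0 ?(ltW m0) // invf_le1.
Qed.

Lemma retract_lipschitz E (p : E) (a : R) x y : 0 < a ->
  `|retract p a x - retract p a y| <= 2 * `|x - y|.
Proof.
move=> a0; rewrite /retract opprD addrACA subrr add0r.
by rewrite (le_trans (radial_lipschitz _ _ a0)) // opprB addrA subrK.
Qed.

Lemma is_derive_scale_arg E (f : R -> E) (k s : R) l :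
  is_derive (k * s) 1 f l -> is_derive s 1 (fun s => f (k * s)) (k *: l).
Proof.
move=> /(is_derive_scalev k) H.
have := @is_derive_line _ _ _ f 0 k s (k *: l).
rewrite add0r (_ : s *: k = k * s) ?[s *: k]mulrC // => /(_ _).
rewrite [k *: 1]mulr1 in H => /(_ H).
by under eq_fun do rewrite add0r [_ *: k]mulrC.
Qed.

Lemma is_derive_right_unique E (f g : R -> E) (s : R) (a b : E) :
  is_derive s 1 f a -> is_derive s 1 g b ->
  (\forall h \near (0 : R)^'+, f (s + h) = g (s + h)) -> f s = g s -> a = b.
Proof.
move=> /is_derive_epsP Hf /is_derive_epsP Hg fg fgs.
apply/eqP; rewrite -subr_eq0 -normr_le0; apply/ler_addgt0Pr => e e0.
rewrite add0r.
have e2 : 0 < e / 2 by rewrite divr_gt0.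
have Hf' := cvg_at_right_filter (@cvg_id _ (nbhs (0:R))) (Hf _ e2).
have Hg' := cvg_at_right_filter (@cvg_id _ (nbhs (0:R))) (Hg _ e2).
near (0 : R)^'+ => h.
have h0 : 0 < h by near: h; exact: nbhs_right_gt.
have H1 : `|f (s + h *: 1) - f s - h *: a| <= e / 2 * `|h| by near: h.
have H2 : `|g (s + h *: 1) - g s - h *: b| <= e / 2 * `|h| by near: h.
have H3 : f (s + h) = g (s + h) by near: h.
rewrite !(gtr0_norm h0) ![h *: 1]mulr1 H3 fgs in H1 H2.
rewrite -(ler_pM2l h0) -[X in X * _](gtr0_norm h0) -normrZ scalerBr.
have -> : h *: a - h *: b = (g (s + h) - g s - h *: b) - (g (s + h) - g s - h *: a).
  by rewrite opprB [RHS]addrC addrA subrK.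
rewrite (le_trans (ler_normB _ _)) //; lra.
Unshelve. all: by end_near. Qed.

End LocalFlow.

Section LocalFlowTheorem.
Context {R : realType}.
Implicit Types E F : normedModType R.

Definition flow_box E (p : E) (r : R) : set (E * R) :=
  [set q | `|p - q.1| < r /\ `|q.2| < r].

Lemma open_flow_box E (p : E) (r : R) : open (flow_box p r).
Proof.
rewrite (_ : flow_box p r = (fst @^-1` ball p r) `&` (snd @^-1` ball (0 : R) r)).
  apply: openI; apply: open_comp; try exact: ball_open.
    by move=> q _; exact: cvg_fst.
  by move=> q _; exact: cvg_snd.
by apply/seteqP; split=> [[x t]|[x t]]; rewrite /= -!ball_normE /= sub0r normrN.
Qed.

(** Composing G with a retraction makes it bounded and globally Lipschitz without
    changing it near p. Time is treated as an initial condition: for (x, t)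
    near (p, 0) solve X' = t G(X) on [0, 1] from x and put Phi(x, t) = X(1).
    The field (x, t) |-> (t G(x), 0) is smooth, so Phi is smooth jointly in
    x and t; rescaling, Phi(x, s t) = X(s), which gives the equation of the
    flow. *)
Theorem local_flow E (U : set E) (G : E -> E) (p : E) :
  picard_space E -> open U -> U p -> smooth U G ->
  exists (r : R) (Phi : E * R -> E),
    [/\ 0 < r, smooth (flow_box p r) Phi,
        forall x, `|p - x| < r -> Phi (x, 0) = x &
        forall x t, `|p - x| < r -> `|t| < r ->
          U (Phi (x, t)) /\
          is_derive t 1 (fun t => Phi (x, t)) (G (Phi (x, t)))].
Proof.
move=> Ep Uo Up GS.
have [a a0 Ha] := Ck1_locally_bounded Uo Up (GS 1%N).
have Ha' z : `|p - z| < a -> U z /\ forall v, `|'D_v G z| <= a^-1 * `|v|.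
  by move=> /Ha[Uz Hz]; split=> // v; rewrite mulrC.
have Glip := locally_bounded_lipschitz (GS 1%N) Ha'.
have ai : 0 < a^-1 by rewrite invr_gt0.
have a2 : 0 < a / 2 by rewrite divr_gt0.
have a2a : a / 2 < a by rewrite gtr_pMr // invf_lt1 // ltr1n.
pose rho := retract p (a / 2).
have rhoa x : `|p - rho x| < a := le_lt_trans (retract_in p x a2) a2a.
pose K := a^-1 * 2.
have K0 : 0 <= K by rewrite mulr_ge0 // ltW.
have Grho x y : `|G (rho x) - G (rho y)| <= K * `|x - y|.
  rewrite (le_trans (Glip _ _ (rhoa y) (rhoa x))) // -mulrA ler_wpM2l ?(ltW ai) //.
  exact: retract_lipschitz.
pose M := `|G p| + 1.
have M0 : 0 < M by rewrite ltr_wpDl.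
have GM x : `|G (rho x)| <= M.
  rewrite -[G _](subrK (G p)) (le_trans (ler_normD _ _)) // addrC lerD2l.
  have pp : `|p - p| < a by rewrite subrr normr0.
  rewrite (le_trans (Glip _ _ pp (rhoa x))) // mulrC ler_pdivrMr // mul1r.
  by rewrite ltW // distrC.
have /choice[X XP] : forall q : E * R, exists X : R -> E, X 0 = q.1 /\
    forall s : R, 0 <= s <= 1 -> is_derive s 1 X (q.2 *: G (rho (X s))).
  move=> [x t].
  apply: (@picard _ _ (fun _ y => t *: G (rho y)) (`|t| * K) x Ep).
  - by rewrite mulr_ge0.
  - by move=> _ y z; rewrite -scalerBr normrZ -mulrA ler_wpM2l.
  - move=> Y Yc s; apply: cvgZ; first exact: cvg_cst.
    apply/cvgrPdist_le => e e0.
    have eK : 0 < e / (K + 1) by rewrite divr_gt0 // ltr_wpDl.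
    move/cvgrPdist_le : (Yc s) => /(_ _ eK); apply: filterS => u.
    rewrite ler_pdivlMr ?ltr_wpDl // => su; rewrite (le_trans (Grho _ _)) //.
    by rewrite (le_trans _ su) // mulrC ler_wpM2l // lerDl.
pose r := a / 2 / (1 + M).
have r0 : 0 < r by rewrite divr_gt0 // addr_gt0.
have rM : r + r * M = a / 2.
  by rewrite /r; field; rewrite gt_eqF // addr_gt0.
have Xstay x t (s : R) : `|p - x| < r -> `|t| < r -> 0 <= s <= 1 ->
    `|p - X (x, t) s| <= a / 2.
  move=> px tr s01; have [X0 XD] := XP (x, t).
  have /andP[s0 s1] := s01.
  have := @mean_value_inequality _ _ (X (x, t))
    (fun u => t *: G (rho (X (x, t) u))) (fun u => (`|t| * M) * u)
    (fun=> `|t| * M) 0 s s0.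
  rewrite X0 /= mulr0 subr0 => H.
  have {}H : `|X (x, t) s - x| <= `|t| * M * s.
    apply: H.
    - by move=> u /andP[u0 us]; apply: XD; rewrite u0 (le_trans us).
    - by move=> u _; apply: is_derive_eq; rewrite /GRing.scale /= mulr1.
    - by move=> u _; rewrite normrZ ler_wpM2l.
  rewrite -(subrKA x) (le_trans (ler_normD _ _)) // -rM lerD ?(ltW px) //.
  rewrite distrC (le_trans H) // (@le_trans _ _ (`|t| * M)) //.
    by rewrite ler_piMr // mulr_ge0 // ltW.
  by rewrite ler_pM2r // ltW.
have Xode x t (s : R) : `|p - x| < r -> `|t| < r -> 0 <= s <= 1 ->
    U (X (x, t) s) /\ is_derive s 1 (X (x, t)) (t *: G (X (x, t) s)).
  move=> px tr s01; have H := Xstay _ _ _ px tr s01; split.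
    by apply: (Ha _ _).1; exact: le_lt_trans a2a.
  by have [_ /(_ _ s01)] := XP (x, t); rewrite /rho retract_id.
(* Rescaling time turns the solution with speed t into that with speed s t. *)
have Xscale x t (s : R) : 0 <= s <= 1 -> X (x, s * t) 1 = X (x, t) s.
  move=> s01; have [X0 XD] := XP (x, s * t); have [Y0 YD] := XP (x, t).
  pose y u := X (x, s * t) u - X (x, t) (s * u).
  have yD (u : R) : 0 <= u <= 1 -> is_derive u 1 y
     ((s * t) *: G (rho (X (x, s * t) u)) - s *: (t *: G (rho (X (x, t) (s * u))))).
    move=> u01; apply: is_deriveB; first exact: XD.
    apply: is_derive_scale_arg; apply: YD.
    have /andP[s0 s1] := s01; have /andP[u0 u1] := u01.
    by rewrite mulr_ge0 //= mulr_ile1.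
  have L0 : 0 <= `|s * t| * K by rewrite mulr_ge0.
  have o01 : 0 <= (1 : R) <= 1 by rewrite ler01 lexx.
  have : `|y 1| <= 2 * (0 + 0 * 1) * expR (2 * (`|s * t| * K) * 1).
    apply: (gronwall L0 (lexx 0) ler01 yD _ _ o01).
      move=> u _; rewrite addr0 scalerA -scalerBr normrZ -mulrA ler_wpM2l //.
    by rewrite /y mulr0 X0 Y0 subrr normr0.
  rewrite mul0r addr0 mulr0 mul0r normr_le0 subr_eq0 mulr1.
  by move/eqP.
pose Phi (q : E * R) := X q 1.
have PhiS : smooth (flow_box p r) Phi.
  pose G' (q : E * R) := (q.2 *: G q.1, 0 : R).
  have U'o := @open_setX_setT E R U Uo.
  have G'S : smooth (U `*` [set: R]) G'.
    move=> n.
    have C1 : Ck n (U `*` [set: R]) fst by exact: Ck_fst.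
    have C2 : Ck n (U `*` [set: R]) snd by exact: Ck_snd.
    apply: Ck_pair => //; last exact: Ck_cst.
    apply: Ck_scale => //.
    by apply: (Ck_comp U'o _ C1 (GS n)) => q [].
  move=> n; have Qo := @open_flow_box _ p r.
  have FC := @flow_Ck _ n _ _ _ _ (fun q s => (X q s, q.2))
    (picard_space_prod Ep picard_space_real) U'o Qo G'S.
  suff /FC H : solution_family (U `*` [set: R]) G' (flow_box p r)
      (fun q s => (X q s, q.2)).
    apply: (@Ck_comp _ _ _ _ _ _ setT (fun q => (X q 1, q.2)) fst) => //.
    by apply: Ck_fst; exact: openT.
  move=> [x t] [/= px tr]; split; first by rewrite (XP (x, t)).1.
  move=> s s01; have [Us Ds] := Xode _ _ _ px tr s01; split; first by split.
  by apply: is_derive_pair => //; exact: is_derive_cst.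
exists r, Phi; split => //.
  by move=> x px; rewrite /Phi -(mul0r 0) Xscale ?lexx ?ler01 // (XP (x, 0)).1.
move=> x t px tr; split.
  by apply: (Xode _ _ _ px tr _).1; rewrite ler01 lexx.
(* Phi is differentiable in t, so its derivative can be read off from the right
   along the curve s |-> Phi (x, s t0), where t = s t0 with 0 <= s < 1. *)
have PD : is_derive t 1 (fun t => Phi (x, t)) ('D_(0, 1) Phi (x, t)).
  have /is_derive_epsP H : is_derive (x, t) (0, 1 : R) Phi ('D_(0, 1) Phi (x, t)).
    apply/derivableP/diff_derivable; have [+ _] := PhiS 1%N; apply.
    by split.
  apply/is_derive_epsP => e /H; apply: filterS => h.
  have -> // : (x, t) + h *: (0, 1) = (x, t + h *: 1).
  by apply/pair_equal_spec; rewrite /= scaler0 addr0.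
(* Pick t0 of the sign of t with |t| < |t0| < r. *)
have [t0 [s [t00 t0r /andP[s0 s1] tE]]] : exists t0 s : R,
    [/\ t0 != 0, `|t0| < r, 0 <= s < 1 & t = s * t0].
  pose c := (`|t| + r) / 2.
  have tc : `|t| < c by rewrite /c; lra.
  have cr : c < r by rewrite /c; lra.
  have c0 : 0 < c by exact: le_lt_trans tc.
  have [t_ge0|t_lt0] := leP 0 t.
    exists c, (t / c); rewrite gt_eqF // gtr0_norm // cr divr_ge0 ?(ltW c0) //=.
    rewrite ltr_pdivrMr // mul1r divfK ?gt_eqF //; split=> //.
    by move: tc; rewrite ger0_norm.
  exists (- c), (- t / c); rewrite oppr_eq0 gt_eqF // normrN gtr0_norm // cr.
  rewrite divr_ge0 ?(ltW c0) ?oppr_ge0 ?(ltW t_lt0) //=.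
  rewrite ltr_pdivrMr // mul1r mulrN mulNr mulNr opprK divfK ?gt_eqF //; split=> //.
  by move: tc; rewrite ltr0_norm.
have s01 : 0 <= s <= 1 by rewrite s0 ltW.
have D1 : is_derive s 1 (fun s => Phi (x, t0 * s)) (t0 *: 'D_(0, 1) Phi (x, t)).
  apply: (@is_derive_scale_arg _ _ (fun t => Phi (x, t))).
  by rewrite mulrC -tE.
have D2 := (Xode x t0 s px t0r s01).2.
have Xs : X (x, t0) s = Phi (x, t) by rewrite tE /Phi Xscale.
have E12 : t0 *: 'D_(0, 1) Phi (x, t) = t0 *: G (X (x, t0) s).
  apply: (is_derive_right_unique D1 D2); last by rewrite Xs mulrC -tE.
  near=> h; rewrite mulrC /Phi Xscale //.
  have h0 : 0 < h by near: h; exact: nbhs_right_gt.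
  rewrite addr_ge0 ?(ltW h0) //= -lerBrDl.
  by near: h; apply: nbhs_right_le; rewrite subr_gt0.
by move: E12 => /(scalerI t00); rewrite Xs => <-.
Unshelve. all: by end_near. Qed.

End LocalFlowTheorem.

(** * Curves moving normally to a direction field *)

(** The directional derivative as an irreducible constant, so that derivatives
    are told apart by name in computations and never as limits. *)
HB.lock
Definition dd {R : realType} {E F : normedModType R} (v : E) (f : E -> F)
  (p : E) : F := 'D_v f p.

Section Geometry.
Context {R : realType}.
Implicit Types E F G : normedModType R.
Local Notation plane := 'rV[R]_2.
Local Notation spacetime := (plane * R)%type.

Lemma vec2E (a b : R) : vec2 a b = a *: 'e_0 + b *: 'e_1.
Proof. by rewrite [LHS]rV2E !mxE. Qed.

Lemma is_derive_vec2 E (a b : E -> R) x v da db :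
  is_derive x v a da -> is_derive x v b db ->
  is_derive x v (fun y => vec2 (a y) (b y)) (vec2 da db).
Proof.
have lin (e : plane) : linear (fun k : R^o => k *: e).
  by move=> k y z; rewrite scalerDl scalerA.
move=> Da Db; under eq_fun do rewrite vec2E; rewrite vec2E.
apply: is_deriveD.
  apply: (@is_derive_linear_comp _ _ _ _ a (fun k : R => k *: 'e_0)) => //.
  exact: scalel_continuous.
apply: (@is_derive_linear_comp _ _ _ _ b (fun k : R => k *: 'e_1)) => //.
exact: scalel_continuous.
Qed.

Lemma is_derive_comp_diff E F G (f df : E -> F) (g dg : F -> G) x v :
  is_diff x f df -> is_diff (f x) g dg ->
  is_derive x v (fun y => g (f y)) (dg (df v)).
Proof. by move=> Hf Hg; exact: (is_diff_is_derive v (is_diff_comp Hf Hg)). Qed.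

Lemma is_derive_dd E F (f : E -> F) x v d : is_derive x v f d -> dd v f x = d.
Proof. by move=> [_ <-]; rewrite dd.unlock. Qed.

Lemma smooth_is_diff_dd E F (U : set E) (f : E -> F) x : open U ->
  smooth U f -> U x -> is_diff x f (fun v => dd v f x).
Proof. by move=> Uo fS Ux; rewrite dd.unlock; exact: smooth_is_diff fS Ux. Qed.

Lemma smooth_is_derive E F (U : set E) (f : E -> F) x v : open U ->
  smooth U f -> U x -> is_derive x v f (dd v f x).
Proof.
by move=> Uo fS Ux; exact: (is_diff_is_derive v (smooth_is_diff_dd Uo fS Ux)).
Qed.

Lemma smooth_dd E F (U : set E) (f : E -> F) v : open U ->
  smooth U f -> smooth U (dd v f).
Proof. by move=> Uo fS; rewrite dd.unlock; exact: smooth_derive. Qed.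

Lemma dd_comm E F (U : set E) (f : E -> F) x u v : open U -> smooth U f ->
  U x -> dd u (dd v f) x = dd v (dd u f) x.
Proof. by move=> Uo fS Ux; rewrite dd.unlock; exact: derive_comm (fS 2) Ux. Qed.

Lemma smooth_chain E F G (Q : set E) (N : set F) (P : E -> F) (f : F -> G) q v :
  open Q -> smooth Q P -> Q q -> open N -> smooth N f -> N (P q) ->
  is_derive q v (fun q => f (P q)) (dd (dd v P q) f (P q)).
Proof.
move=> Qo PS Qq No fS NP.
exact: (is_derive_comp_diff v (smooth_is_diff_dd Qo PS Qq)
                              (smooth_is_diff_dd No fS NP)).
Qed.

Lemma is_derive_fst E F G (f : E * F -> G) x y v d :
  is_derive (x, y) (v, 0) f d -> is_derive x v (fun x => f (x, y)) d.
Proof.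
move=> /is_derive_epsP H; apply/is_derive_epsP => e /H; apply: filterS => h.
have -> // : (x, y) + h *: (v, 0) = (x + h *: v, y).
by apply/pair_equal_spec; rewrite /= scaler0 addr0.
Qed.

Lemma is_derive_snd E F G (f : E * F -> G) x y v d :
  is_derive (x, y) (0, v) f d -> is_derive y v (fun y => f (x, y)) d.
Proof.
move=> /is_derive_epsP H; apply/is_derive_epsP => e /H; apply: filterS => h.
have -> // : (x, y) + h *: (0, v) = (x, y + h *: v).
by apply/pair_equal_spec; rewrite /= scaler0 addr0.
Qed.

Lemma is_derive_coord E (f : E -> plane) x v d (j : 'I_2) :
  is_derive x v f d -> is_derive x v (fun y => f y 0 j) (d 0 j).
Proof.
move=> H; apply: (@is_derive_linear_comp _ _ _ _ f (fun z => z 0 j)) => //.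
  by move=> k a b; rewrite !mxE.
exact: coord_continuous.
Qed.

Definition e_x : spacetime := ('e_0, 0).

Definition e_y : spacetime := ('e_1, 0).

Lemma derive_space F (N : set spacetime) (f : spacetime -> F) p (v : plane) :
  open N -> smooth N f -> N p ->
  dd (v, 0 : R) f p = v 0 0 *: dd e_x f p + v 0 1 *: dd e_y f p.
Proof.
move=> No fS Np; have df : differentiable f p by have [+ _] := fS 1%N; exact.
rewrite dd.unlock -!deriveZv // !(deriveE _ df) -raddfD; congr ('d f p _).
by apply/pair_equal_spec; rewrite /= -rV2E !scaler0 addr0.
Qed.

Lemma derive_spacetime F (N : set spacetime) (f : spacetime -> F) p (v : plane) :
  open N -> smooth N f -> N p ->
  dd (v, 1 : R) f p = dd (v, 0 : R) f p + dd (0 : plane, 1 : R) f p.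
Proof.
move=> No fS Np; have df : differentiable f p by have [+ _] := fS 1%N; exact.
rewrite dd.unlock !(deriveE _ df) -raddfD; congr ('d f p _).
by apply/pair_equal_spec; rewrite /= addr0 add0r.
Qed.

Variables (N : set spacetime) (g : spacetime -> R).
Hypotheses (No : open N) (gS : smooth N g).

Definition unit_dir (p : spacetime) : plane := vec2 (cos (g p)) (sin (g p)).
Definition normal_dir (p : spacetime) : plane := vec2 (- sin (g p)) (cos (g p)).

(** The curvature of the integral curve through p: the derivative of the angle
    along the direction field. *)
Definition curv (p : spacetime) : R :=
  dd e_x g p * cos (g p) + dd e_y g p * sin (g p).

Lemma smooth_cos : smooth N (fun p => cos (g p)).
Proof. by move=> n; apply: (Ck_comp No _ (gS n) (Ck_cos_sin n).1). Qed.

Lemma smooth_sin : smooth N (fun p => sin (g p)).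
Proof. by move=> n; apply: (Ck_comp No _ (gS n) (Ck_cos_sin n).2). Qed.

Lemma smooth_curv : smooth N curv.
Proof.
move=> n; apply: Ck_add => //; apply: (@Ck_scale _ _ _ R) => //.
- exact: smooth_dd.
- exact: smooth_cos.
- exact: smooth_dd.
- exact: smooth_sin.
Qed.

Lemma smooth_vec2 (a b : spacetime -> R) : smooth N a -> smooth N b ->
  smooth N (fun p => vec2 (a p) (b p)).
Proof.
move=> aS bS n.
apply: (@eq_Ck _ _ _ _ N (fun p => a p *: 'e_0 + b p *: 'e_1)) => //.
  by move=> p _; rewrite vec2E.
by apply: Ck_add => //; apply: Ck_scale => //; exact: Ck_cst.
Qed.

Lemma smooth_unit_dir : smooth N unit_dir.
Proof. by apply: smooth_vec2; [exact: smooth_cos|exact: smooth_sin]. Qed.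

Lemma smooth_normal_dir : smooth N normal_dir.
Proof.
apply: smooth_vec2; last exact: smooth_cos.
by move=> n; apply: Ck_opp => //; exact: smooth_sin.
Qed.

Lemma smooth_mcv : smooth N (fun p => curv p *: normal_dir p).
Proof.
by move=> n; apply: Ck_scale => //; [exact: smooth_curv|exact: smooth_normal_dir].
Qed.

Lemma is_derive_cosg p v : N p ->
  is_derive p v (fun p => cos (g p)) (- (sin (g p) * dd v g p)).
Proof.
move=> Np; have H := smooth_is_diff_dd No gS Np.
have Hc : is_diff (g p) (@cos R) (fun v => v * - sin (g p)).
  have D := is_derive_cos (g p); apply: DiffDef; first exact/derivable1_diffP.
  by rewrite deriv1E // derive1E derive_val.
by have := is_derive_comp_diff v H Hc; rewrite mulrN mulrC.
Qed.

Lemma is_derive_sing p v : N p ->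
  is_derive p v (fun p => sin (g p)) (cos (g p) * dd v g p).
Proof.
move=> Np; have H := smooth_is_diff_dd No gS Np.
have Hc : is_diff (g p) (@sin R) (fun v => v * cos (g p)).
  have D := is_derive_sin (g p); apply: DiffDef; first exact/derivable1_diffP.
  by rewrite deriv1E // derive1E derive_val.
by have := is_derive_comp_diff v H Hc; rewrite mulrC.
Qed.

Lemma derive_curv p v : N p ->
  dd v curv p = dd v (dd e_x g) p * cos (g p)
    - dd e_x g p * sin (g p) * dd v g p
    + dd v (dd e_y g) p * sin (g p)
    + dd e_y g p * cos (g p) * dd v g p.
Proof.
move=> Np.
have D0 := smooth_is_derive v No (smooth_dd e_x No gS) Np.
have D1 := smooth_is_derive v No (smooth_dd e_y No gS) Np.
have Dc := is_derive_cosg v Np; have Ds := is_derive_sing v Np.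
have D : is_derive p v curv _ := is_deriveD (is_deriveM D0 Dc) (is_deriveM D1 Ds).
rewrite (is_derive_dd D) /GRing.scale /=; ring.
Qed.

(** This is the geometric content of the equation. Write V and n for the unit
    and normal directions and k for the curvature, the derivative of g along V.
    Then V(k) = g''(V, V) + k n(g), while a point moving with velocity k n sees
    the angle change at the rate g_t + k n(g); the two agree exactly when
    g_t = g''(V, V). *)
Lemma angle_along_flow p : N p ->
  dd (0 : plane, 1 : R) g p = dd e_x (dd e_x g) p * cos (g p) ^+ 2
    + 2 * dd e_x (dd e_y g) p * sin (g p) * cos (g p)
    + dd e_y (dd e_y g) p * sin (g p) ^+ 2 ->
  dd (curv p *: normal_dir p, 1 : R) g p = dd (unit_dir p, 0 : R) curv p.
Proof.
move=> Np heat.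
rewrite (derive_spacetime _ No gS Np) heat.
rewrite (derive_space _ No gS Np) (derive_space _ No smooth_curv Np).
rewrite !derive_curv // (dd_comm e_y e_x No gS Np).
rewrite !mxE /= /curv /GRing.scale /=; ring.
Qed.

Variables (Q : set (R * R)) (P : R * R -> spacetime).
Hypotheses (Qo : open Q) (PS : smooth Q P) (PN : forall q, Q q -> N (P q)).
Hypothesis P_time : forall q, Q q ->
  dd (0 : R, 1 : R) P q = (curv (P q) *: normal_dir (P q), 1).
Hypothesis P_clock : forall q, Q q -> (P q).2 = q.2.

Definition speed (q : R * R) : plane := (dd (1 : R, 0 : R) P q).1.

Lemma derive_space_P q : Q q -> dd (1 : R, 0 : R) P q = (speed q, 0).
Proof.
move=> Qq; rewrite [LHS]surjective_pairing; congr pair.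
have D : is_derive q (1, 0) (fun q => (P q).2) (dd (1 : R, 0 : R) P q).2.
  apply: (@is_derive_linear_comp _ _ _ _ P snd) => //.
    by move=> p; exact: cvg_snd.
  exact: (smooth_is_derive _ Qo PS Qq).
have D' : is_derive q (1, 0) (fun q : R * R => q.2) (0 : R).
  apply: (@is_diff_is_derive _ _ _ snd snd q (1, 0)).
  by apply: is_diff_linear => // p; exact: cvg_snd.
have near_q : \forall q' \near q, (P q').2 = q'.2 by exact: (near_open Qo Qq P_clock).
rewrite -(is_derive_dd (near_eq_is_derive near_q D)).
exact: is_derive_dd D'.
Qed.

(** Mixed derivatives commute, so the velocity of the curves solves the
    linearised flow equation. *)
Lemma derive_speed q : Q q ->
  is_derive q (0, 1) speed (dd (speed q, 0 : R) (fun p => curv p *: normal_dir p) (P q)).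
Proof.
move=> Qq.
have D := smooth_is_derive (0 : R, 1 : R) Qo (smooth_dd (1 : R, 0 : R) Qo PS) Qq.
have cl : continuous (fst : spacetime -> plane) by move=> p; exact: cvg_fst.
have D1 := is_derive_linear_comp (fun _ _ _ => erefl) cl D.
move: D1; rewrite (dd_comm _ _ Qo PS Qq).
have -> // : (dd (1 : R, 0 : R) (dd (0 : R, 1 : R) P) q).1 =
  dd (speed q, 0 : R) (fun p => curv p *: normal_dir p) (P q).
have D2 := smooth_is_derive (1 : R, 0 : R) Qo (smooth_dd (0 : R, 1 : R) Qo PS) Qq.
have D3 := is_derive_linear_comp (fun _ _ _ => erefl) cl D2.
have near_q : \forall q' \near q,
    (dd (0 : R, 1 : R) P q').1 = curv (P q') *: normal_dir (P q').
  by apply: (near_open Qo Qq) => q' /P_time ->.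
rewrite -(is_derive_dd (near_eq_is_derive near_q D3)).
rewrite (is_derive_dd (smooth_chain (1 : R, 0 : R) Qo PS Qq No smooth_mcv (PN Qq))).
by rewrite derive_space_P.
Qed.

Definition normal_part (q : R * R) : R :=
  - sin (g (P q)) * speed q 0 0 + cos (g (P q)) * speed q 0 1.

Definition tangent_part (q : R * R) : R :=
  cos (g (P q)) * speed q 0 0 + sin (g (P q)) * speed q 0 1.

Lemma speedE q : speed q =
  tangent_part q *: unit_dir (P q) + normal_part q *: normal_dir (P q).
Proof.
have cs := cos2Dsin2 (g (P q)).
rewrite [LHS]rV2E [RHS]rV2E /tangent_part /normal_part.
congr (_ *: _ + _ *: _); rewrite !mxE /=.
  rewrite -[LHS]mul1r -cs; ring.
rewrite -[LHS]mul1r -cs; ring.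
Qed.

(** With a and b the normal and tangential parts of the velocity, differentiating
    gives a' = - b g' + D_speed k, where g' is the rate of the angle. As
    D_speed k = b V(k) + a n(k) and g' = V(k), the terms in b cancel. *)
Lemma derive_normal_part q : Q q ->
  dd (curv (P q) *: normal_dir (P q), 1 : R) g (P q) =
    dd (unit_dir (P q), 0 : R) curv (P q) ->
  is_derive q (0, 1) normal_part
    (dd (normal_dir (P q), 0 : R) curv (P q) * normal_part q).
Proof.
move=> Qq heat; have Np := PN Qq.
have Dg := smooth_chain (0 : R, 1 : R) Qo PS Qq No gS Np.
have Dc := smooth_chain (0 : R, 1 : R) Qo PS Qq No smooth_cos Np.
have Ds := smooth_chain (0 : R, 1 : R) Qo PS Qq No smooth_sin Np.
have cE := is_derive_dd (is_derive_cosg (dd (0 : R, 1 : R) P q) Np).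
have sE := is_derive_dd (is_derive_sing (dd (0 : R, 1 : R) P q) Np).
rewrite cE in Dc; rewrite sE in Ds.
rewrite (P_time Qq) heat in Dc Ds.
have Dw := derive_speed Qq.
have D0 := is_derive_coord 0 Dw; have D1 := is_derive_coord 1 Dw.
have DNs : is_derive q (0, 1) (fun q => - sin (g (P q))) _ := is_deriveN Ds.
have Da : is_derive q (0, 1) normal_part _ :=
  is_deriveD (is_deriveM DNs D0) (is_deriveM Dc D1).
apply: (is_derive_eq Da) => {Da}.
have Dk := smooth_is_derive (speed q, 0 : R) No smooth_curv Np.
have Dn : is_derive (P q) (speed q, 0) (fun p => curv p *: normal_dir p)
   (vec2 (dd (speed q, 0 : R) curv (P q) * - sin (g (P q)) +
           curv (P q) * - (cos (g (P q)) * dd (speed q, 0 : R) g (P q)))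
         (dd (speed q, 0 : R) curv (P q) * cos (g (P q)) +
           curv (P q) * - (sin (g (P q)) * dd (speed q, 0 : R) g (P q)))).
  have Ec : (fun p => curv p *: normal_dir p) =
      fun p => vec2 (curv p * - sin (g p)) (curv p * cos (g p)).
    apply/funext => p; rewrite /normal_dir !vec2E scalerDr !scalerA.
    by [].
  rewrite Ec.
  have Dc' := is_derive_cosg (speed q, 0 : R) Np.
  have Ds' := is_derive_sing (speed q, 0 : R) Np.
  have DNs' : is_derive (P q) (speed q, 0) (fun p => - sin (g p)) _ :=
    is_deriveN Ds'.
  have Hx : is_derive (P q) (speed q, 0) (fun p => curv p * - sin (g p)) _ :=
    is_deriveM Dk DNs'.
  have Hy : is_derive (P q) (speed q, 0) (fun p => curv p * cos (g p)) _ :=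
    is_deriveM Dk Dc'.
  apply: is_derive_eq (is_derive_vec2 Hx Hy) _.
  by congr vec2; rewrite /GRing.scale /=; ring.
rewrite (is_derive_dd Dn).
have kw := derive_space (speed q) No smooth_curv Np.
have ku := derive_space (unit_dir (P q)) No smooth_curv Np.
have kn := derive_space (normal_dir (P q)) No smooth_curv Np.
move: kw ku kn; rewrite /normal_part !mxE /=.
generalize (dd (speed q, 0 : R) g (P q)), (dd (speed q, 0 : R) curv (P q)),
  (dd (unit_dir (P q), 0 : R) curv (P q)),
  (dd (normal_dir (P q), 0 : R) curv (P q)), (dd e_x curv (P q)),
  (dd e_y curv (P q)), (curv (P q)) => gw kw ku kn kx ky k.
generalize (cos (g (P q))), (sin (g (P q))), (speed q 0 0), (speed q 0 1).
rewrite /GRing.scale /= => c s x z -> -> ->.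
ring.
Qed.

End Geometry.

(** * Arclength *)

Section Arclength.
Context {R : realType}.
Implicit Types E F G : normedModType R.
Local Notation plane := 'rV[R]_2.
Local Notation spacetime := (plane * R)%type.

(** The inverse of an antiderivative of b, which maps an open interval onto
    ]- d, d[; continuity of b up to the endpoints makes that interval bounded. *)
Lemma arclength_parameter (b : R -> R) (d : R) : 0 < d ->
  (forall x, - d <= x <= d -> {for x, continuous b} /\ 0 < b x) ->
  exists (s0 s1 : R) (sigma : R -> R), [/\ s0 < s1,
    forall s, s0 < s < s1 -> - d < sigma s < d /\
      is_derive s 1 sigma (b (sigma s))^-1 &
    forall x, - d < x < d -> exists2 s, s0 < s < s1 & sigma s = x].
Proof.
move=> d0 bP.
pose f u := b (- d + 2 * d * u).
have [F FD] : exists F : R -> R, forall s : R, 0 <= s <= 1 -> is_derive s 1 F ((f \o clamp 0 1) s).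
  apply: picard_space_real.2; apply: continuous_comp_clamp => // u /andP[u0 u1].
  apply: (@continuous_comp _ _ _ (fun u => - d + 2 * d * u) b).
    by apply: cvgD; [exact: cvg_cst|apply: cvgM; [exact: cvg_cst|exact: cvg_id]].
  apply: (bP _ _).1.
  have : 2 * d * u <= 2 * d * 1 by rewrite ler_pM2l // mulr_gt0.
  have : 0 <= 2 * d * u by rewrite !mulr_ge0 // ltW.
  by move=> *; apply/andP; split; lra.
pose k := (2 * d)^-1.
have k0 : 0 < k by rewrite invr_gt0 mulr_gt0.
have kd : k * (2 * d) = 1 by rewrite mulVf // gt_eqF // mulr_gt0.
have kd2 : k * d = 2^-1.
  by rewrite /k; field; rewrite gt_eqF.
pose B x := 2 * d * F (2^-1 + x * k).
have BD (x : R) : - d <= x <= d -> is_derive x 1 B (b x).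
  move=> /andP[xd1 xd2].
  have x01 : 0 <= 2^-1 + x *: k <= 1.
    have H1 : (- d) * k <= x * k by rewrite ler_pM2r.
    have H2 : x * k <= d * k by rewrite ler_pM2r.
    rewrite /GRing.scale /=; apply/andP; split; lra.
  have D := FD _ x01; rewrite /= clamp_id // in D.
  have D' := is_derive_scalev k D; rewrite [k *: 1]mulr1 in D'.
  have D1 := is_derive_line D'.
  have D2 := is_deriveZ (2 * d) D1; apply: is_derive_eq D2 _.
  rewrite scalerA [2 * d * k]mulrC kd scale1r /f /GRing.scale /=.
  congr b; have -> : 2 * d * (2^-1 + x * k) = 2 * d * 2^-1 + x * (k * (2 * d)) by ring.
  by rewrite kd; field.
have Bc (x : R) : - d <= x <= d -> {for x, continuous B}.
  by move=> /BD; exact: derive_continuous.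
have Bmono (x z : R) : - d <= x -> x < z -> z <= d -> B x < B z.
  move=> dx xz zd.
  have sub (u : R) : x <= u <= z -> - d <= u <= d.
    by move=> /andP[xu uz]; rewrite (le_trans dx) //= (le_trans uz).
  have BDxz u : u \in `]x, z[ -> is_derive u 1 B (b u).
    rewrite in_itv /= => /andP[xu uz]; apply: BD; apply: sub; by rewrite !ltW.
  have Bcxz : {within `[x, z], continuous B}.
    apply: continuous_in_subspaceT => u; rewrite inE /= in_itv /= => /sub.
    exact: Bc.
  have [c] := MVT xz BDxz Bcxz.
  rewrite in_itv /= => /andP[xc cz] E; rewrite -subr_gt0 E mulr_gt0 ?subr_gt0 //.
  by apply: (bP _ _).2; apply: sub; rewrite !ltW.
have dd' : - d < d by lra.
have Binj (x z : R) : - d <= x <= d -> - d <= z <= d -> B x = B z -> x = z.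
  move=> /andP[x1 x2] /andP[z1 z2] Bxz; apply/eqP; apply: contraT.
  rewrite neq_lt => /orP[] H; first by have := Bmono _ _ x1 H z2; rewrite Bxz ltxx.
  by have := Bmono _ _ z1 H x2; rewrite Bxz ltxx.
have /choice[sigma sP] : forall s, exists x : R, B (- d) <= s <= B d ->
    - d <= x <= d /\ B x = s.
  move=> s; have [sB|nsB] := pselect (B (- d) <= s <= B d); last by exists 0.
  have Bcd : {within `[- d, d], continuous B}.
    apply: continuous_in_subspaceT => u; rewrite inE /= in_itv /=; exact: Bc.
  have /ltW Bdd := Bmono _ _ (lexx _) dd' (lexx _).
  have [|x xd Bx] := @IVT _ B (- d) d s (ltW dd') Bcd.
    by rewrite (min_l Bdd) (max_r Bdd).
  by exists x => _; rewrite in_itv /= in xd.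
have sB (x : R) : - d <= x <= d -> sigma (B x) = x.
  move=> xd; have /andP[x1 x2] := xd.
  have Bx : B (- d) <= B x <= B d.
    apply/andP; split.
      move: x1; rewrite le_eqVlt => /orP[/eqP <- //|H].
      by apply/ltW/Bmono.
    move: x2; rewrite le_eqVlt => /orP[/eqP -> //|H].
    by apply/ltW/Bmono.
  by have [H1 H2] := sP _ Bx; apply: Binj.
exists (B (- d)), (B d), sigma; split.
- exact: Bmono.
- move=> s /andP[s1 s2].
  have [/andP[g1 g2] Bs] : - d <= sigma s <= d /\ B (sigma s) = s.
    by apply: sP; rewrite !ltW.
  have g1' : - d < sigma s.
    by rewrite lt_neqAle g1 andbT; apply/eqP => E; rewrite -Bs -E ltxx in s1.
  have g2' : sigma s < d.
    by rewrite lt_neqAle g2 andbT; apply/eqP => E; rewrite -Bs E ltxx in s2.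
  split; first by rewrite g1'.
  rewrite -{1}Bs.
  have nb : \forall x \near sigma s, - d <= x <= d.
    have : sigma s \in `]- d, d[ by rewrite in_itv /= g1'.
    move=> /near_in_itvoo; apply: filterS => x; rewrite in_itv /= => /andP[x1 x2].
    by rewrite !ltW.
  apply: is_derive_inverse.
  + by apply: filterS nb => x; exact: sB.
  + by apply: filterS nb => x; exact: Bc.
  + by apply: BD; rewrite g1.
  + by rewrite gt_eqF //; apply: (bP _ _).2; rewrite g1.
- move=> x /andP[x1 x2]; exists (B x).
    by rewrite !Bmono // ltW.
  by apply: sB; rewrite !ltW.
Qed.

End Arclength.

(** * The lifted angle and its equation *)

Section LiftAndFlow.
Context {R : realType}.
Implicit Types E F G : normedModType R.
Local Notation plane := 'rV[R]_2.
Local Notation spacetime := (plane * R)%type.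

Lemma partialE (i : 'I_2) (f : spacetime -> R) p :
  partial i f p = 'D_('e_i, 0 : R) (f : spacetime -> R^o) p.
Proof.
rewrite /partial /derive.
set u := (fun h : R => _); set v := (fun h : R => _).
suff -> : u = v by [].
apply/funext => h; rewrite /u /v /=.
have -> : h *: ('e_i, 0 : R) + p = (h *: 'e_i + p.1, p.2).
  by apply/pair_equal_spec; rewrite /= scaler0 add0r.
by rewrite -surjective_pairing.
Qed.

Lemma within_derive_unique (A : set R) (f : R -> R^o) (t l d : R) :
  (\forall s \near t^'+, A s) ->
  is_derive_within A f t l -> is_derive t 1 f d -> l = d.
Proof.
move=> At Hl /is_derive_epsP Hd.
have H1 : (fun s => (s - t)^-1 *: (f s - f t)) @ t^'+ --> (l : R^o).
  apply: cvg_trans Hl => S /= HS.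
  have HS1 : \forall s \near t, s != t -> A s -> S ((s - t)^-1 *: (f s - f t)) by [].
  have HS2 : \forall s \near t^'+, A s -> S ((s - t)^-1 *: (f s - f t)).
    rewrite near_withinE; apply: filterS HS1 => s H ts; apply: H.
    by rewrite gt_eqF.
  by apply: filterS2 At HS2 => s As; apply.
have H2 : (fun s => (s - t)^-1 *: (f s - f t)) @ t^'+ --> (d : R^o).
  apply/cvgrPdist_le => e e0.
  have st : (fun s => s - t) @ t^'+ --> (0 : R).
    rewrite -(subrr t); apply: cvgB; last exact: cvg_cst.
    exact: cvg_at_right_filter cvg_id.
  have Hd' : \forall s \near t^'+,
     `|f (t + (s - t) *: 1) - f t - (s - t) *: d| <= e * `|s - t| := st _ (Hd e e0).
  near=> s.
  have s0 : 0 < s - t by rewrite subr_gt0; near: s; exact: nbhs_right_gt.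
  have : `|f (t + (s - t) *: 1) - f t - (s - t) *: d| <= e * `|s - t| by near: s.
  rewrite [_ *: 1]mulr1 [t + _]addrC subrK (gtr0_norm s0) => H.
  rewrite -[d](scalerK (lt0r_neq0 s0)) -scalerBr normrZ normfV gtr0_norm //.
  by rewrite distrC ler_pdivrMl // mulrC.
exact: (cvg_unique _ H1 H2).
Unshelve. all: by end_near. Qed.

(** The extension across time 0 provided by smoothness of a lift is again a lift
    on W. Hence the equation holds for this single smooth function, at the
    points of the neighbourhood that lie in W. *)
Lemma local_smooth_lift (T : \bar R) (W : set spacetime)
    (theta : spacetime -> angle R) (y : plane) :
  rel_open T W -> smooth_angle W theta -> W (y, 0) ->
  exists (N : set spacetime) (g : spacetime -> R),
    [/\ open N, N (y, 0), smooth N g, smooth_lift W theta N g &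
        forall p, N p -> 0 <= p.2 -> (p.2%:E < T)%E -> W p].
Proof.
move=> [V [Vo WV]] sa Wy.
have [U [f [Uy [Uo fS fl]]]] := sa _ Wy.
have [U' [g [U'o U'y gS fg]]] := fS _ (conj Wy Uy).
have Vy : V (y, 0) by move: Wy; rewrite WV => -[].
pose N := U `&` U' `&` V.
have No : open N by apply: openI => //; exact: openI.
exists N, g; split.
- exact: No.
- by split.
- apply: (smooth_open_smooth frame_spacetime No).
  by move=> vs p [[_ U'p] _]; exact: gS.
- split=> //.
  + move=> p [_ [[_ U'p] _]]; exists U', g.
    by split=> // vs q U'q; exact: gS.
  + by move=> p Wp [[Up U'p] _]; rewrite fl // fg.
- by move=> p [_ Vp] p0 pT; rewrite WV; split.
Qed.

Lemma lift_heat_equation (T : \bar R) (W : set spacetime)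
    (theta : spacetime -> angle R) (N : set spacetime) (g : spacetime -> R) p :
  angle_equation W theta -> open N -> smooth N g -> smooth_lift W theta N g ->
  (forall p, N p -> 0 <= p.2 -> (p.2%:E < T)%E -> W p) ->
  N p -> 0 <= p.2 -> (p.2%:E < T)%E ->
  dd (0 : plane, 1 : R) g p = dd e_x (dd e_x g) p * cos (g p) ^+ 2
    + 2 * dd e_x (dd e_y g) p * sin (g p) * cos (g p)
    + dd e_y (dd e_y g) p * sin (g p) ^+ 2.
Proof.
move=> heq No gS gl NW Np p0 pT.
have Wp := NW _ Np p0 pT.
case: p Np p0 pT Wp => z t Np /= t0 tT Wp.
have := heq _ _ gl z t Wp Np.
have [_ _ /(_ _ Wp Np) ->] := gl.
rewrite /= cos_to_angle sin_to_angle.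
have E1 i : partial i g = 'D_('e_i, 0 : R) g by apply/funext => q; rewrite partialE.
have E2 i j : partial i (partial j g) (z, t) =
    'D_('e_i, 0 : R) ('D_('e_j, 0 : R) g) (z, t).
  by rewrite E1 partialE.
rewrite !E2 dd.unlock => H.
symmetry; apply: within_derive_unique H _.
- have zc : {for t, continuous (fun s : R => (z, s))}.
    by apply: continuous_pair; [exact: cvg_cst|exact: cvg_id].
  have nN : \forall s \near t^'+, N (z, s).
    have Nn : nbhs (z, t) N by exact: open_nbhs_nbhs.
    have nN : \forall s \near t, N (z, s) by exact: (zc N Nn).
    by rewrite near_withinE; apply: filterS nN.
  have nT : \forall s \near t^'+, (s%:E < T)%E.
    case: T tT {NW} => [u| |] //; rewrite ?lte_fin => tu.
      by near=> s; rewrite lte_fin; near: s; exact: nbhs_right_lt.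
    by apply: filterE => s; exact: ltry.
  near=> s.
  have Ns : N (z, s) by near: s.
  split=> //; apply: NW => //=; last by near: s.
  by rewrite (le_trans t0) // ltW //; near: s; exact: nbhs_right_gt.
- by apply: is_derive_snd; have := smooth_is_derive (0 : plane, 1 : R) No gS Np; rewrite dd.unlock.
Unshelve. all: by end_near. Qed.

End LiftAndFlow.

(** * Construction of the flowing curves *)

Section FlowingCurves.
Context {R : realType}.
Implicit Types E F G : normedModType R.
Local Notation plane := 'rV[R]_2.
Local Notation spacetime := (plane * R)%type.

Lemma unit_slope (f : R -> R) (r : R) :
  (forall t : R, `|t| < r -> is_derive t 1 f 1) -> f 0 = 0 ->
  forall t, `|t| < r -> f t = t.
Proof.
move=> fD f0.
have aux (a b : R) : a <= b -> `|a| < r -> `|b| < r -> f b - b = f a - a.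
  move=> ab ar br; apply/eqP; rewrite -subr_eq0 -normr_le0.
  have := @mean_value_inequality _ _ (fun t => f t - t) (fun=> 1 - 1) (fun=> 0)
    (fun=> 0) a b ab.
  rewrite subr0; apply.
  - move=> s /andP[a_s sb]; apply: is_deriveB; apply: fD.
    move: ar br; rewrite !ltr_norml => /andP[ar _] /andP[_ br].
    by rewrite (lt_le_trans ar) //= (le_lt_trans sb).
  - by move=> s _; rewrite subrr normr0.
move=> t tr; apply/eqP; rewrite -subr_eq0; apply/eqP.
have r0 : `|0 : R| < r by rewrite normr0 (le_lt_trans _ tr).
have f00 : f 0 - 0 = 0 by rewrite f0 subr0.
by have [t0|/ltW t0] := leP 0 t; [rewrite (aux 0)|rewrite -(aux t 0)].
Qed.

(** P(x, t) flows the point of parameter x of the integral curve through y at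
    time 0 during time t, by the field (k n, 1) on spacetime; the second
    component records the time. *)
Lemma flowing_curves (N : set spacetime) (g : spacetime -> R) (y : plane) :
  open N -> smooth N g -> N (y, 0) ->
  exists (d : R) (P : R * R -> spacetime), 0 < d /\
    [/\ smooth (flow_box (0 : R) d) P,
        forall q, flow_box (0 : R) d q -> [/\ N (P q),
          dd (0 : R, 1 : R) P q = (curv g (P q) *: normal_dir g (P q), 1) &
          (P q).2 = q.2],
        forall x, `|x| < d -> speed P (x, 0) = unit_dir g (P (x, 0)) &
        P (0, 0) = (y, 0)].
Proof.
move=> No gS Ny.
pose U0 : set plane := [set z | N (z, 0)].
have zc : continuous (fun z : plane => (z, 0 : R)).
  move=> z; apply: (@continuous_pair _ _ _ id (fun=> 0 : R)); first exact: cvg_id.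
  exact: cst_continuous.
have U0o : open U0.
  by apply: (@open_comp _ _ (fun z : plane => (z, 0 : R))) => // z _; exact: zc.
have z0S (U : set plane) n : open U -> Ck n U (fun z : plane => (z, 0 : R)).
  by move=> Uo; apply: Ck_pair => //; [exact: Ck_id|exact: Ck_cst].
have G0S : smooth U0 (fun z => unit_dir g (z, 0)).
  by move=> n; apply: (Ck_comp U0o _ (z0S U0 n U0o) (smooth_unit_dir No gS n)).
have [r1 [Phi1 [r10 Phi1S Phi10 Phi1D]]] :=
  local_flow (@picard_space_plane R) U0o Ny G0S.
have G1S : smooth N (fun p => (curv g p *: normal_dir g p, 1 : R)).
  by move=> n; apply: Ck_pair => //; [exact: smooth_mcv|exact: Ck_cst].
have [r2 [Phi2 [r20 Phi2S Phi20 Phi2D]]] :=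
  local_flow (picard_space_prod (@picard_space_plane R) picard_space_real)
    No Ny G1S.
have yy : `|y - y| < r1 by rewrite subrr normr0.
pose c x := Phi1 (y, x).
have I1o : open (ball (0 : R) r1) by exact: ball_open.
have cS : smooth (ball (0 : R) r1) c.
  move=> n; apply: (Ck_comp I1o _ _ (Phi1S n)).
    by move=> x; rewrite -ball_normE /= sub0r normrN => xr; split.
  by apply: Ck_pair => //; [exact: Ck_cst|exact: Ck_id].
have c0 : c 0 = y by apply: Phi10.
have [d [d0 dr1 dr2 dc]] : exists d, [/\ 0 < d, d <= r1, d <= r2 &
    forall x, `|x| < d -> `|y - c x| < r2].
  have cc : {for 0, continuous c}.
    by apply: (Ck_continuous (cS 0%N)); exact: ballxx.
  move/cvgrPdist_lt : cc => /(_ _ r20); rewrite c0 => /nbhs_normP[e /= e0 He].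
  exists (Num.min e (Num.min r1 r2)); split.
  - by rewrite !lt_min e0 r10.
  - by rewrite !ge_min lexx orbT.
  - by rewrite !ge_min lexx !orbT.
  - move=> x xd; apply: He; rewrite /= sub0r normrN (lt_le_trans xd) //.
    by rewrite ge_min lexx.
pose P (q : R * R) := Phi2 ((c q.1, 0), q.2).
have Qo := @open_flow_box _ R 0 d.
have boxP q : flow_box (0 : R) d q -> `|q.1| < d /\ `|q.2| < d.
  by move=> [H1 H2]; rewrite sub0r normrN in H1.
have close x : `|x| < d -> `|(y, 0 : R) - (c x, 0 : R)| < r2.
  by move=> xd; rewrite prod_normE /= gt_max subrr normr0 r20 dc.
have PS : smooth (flow_box (0 : R) d) P.
  move=> n; apply: (Ck_comp Qo _ _ (Phi2S n)).
    move=> q /boxP[q1 q2]; split; first exact: close.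
    exact: lt_le_trans dr2.
  apply: Ck_pair => //; last exact: Ck_snd.
  apply: Ck_pair => //; last exact: Ck_cst.
  apply: (Ck_comp Qo _ (Ck_fst n Qo) (cS n)) => q /boxP[q1 _].
  by rewrite -ball_normE /= sub0r normrN (lt_le_trans q1).
have PD q : flow_box (0 : R) d q ->
    dd (0 : R, 1 : R) P q = (curv g (P q) *: normal_dir g (P q), 1).
  move=> Qq; have [q1 q2] := boxP _ Qq.
  have [_ D] := Phi2D _ _ (close _ q1) (lt_le_trans q2 dr2).
  have D' : is_derive q.2 1 (fun t => P (q.1, t)) (dd (0 : R, 1 : R) P q).
    apply: is_derive_snd; rewrite -surjective_pairing.
    exact: smooth_is_derive Qq.
  by have [_ <-] := D'; have [_ ->] := D.
exists d, P; split=> //; split=> //.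
- move=> q Qq; have [q1 q2] := boxP _ Qq; split.
  + by have [] := Phi2D _ _ (close _ q1) (lt_le_trans q2 dr2).
  + exact: PD.
  + rewrite /P; apply: (@unit_slope (fun t => (Phi2 ((c q.1, 0), t)).2) r2).
    * move=> t tr; have [_ D] := Phi2D _ _ (close _ q1) tr.
      have sc : continuous (snd : spacetime -> R) by move=> p; exact: cvg_snd.
      exact: (is_derive_linear_comp (fun _ _ _ => erefl) sc D).
    * by rewrite Phi20 //; exact: close.
    * exact: lt_le_trans dr2.
- move=> x xd; rewrite /speed.
  have Qx : flow_box (0 : R) d (x, 0).
    by split; rewrite /= ?sub0r ?normrN ?normr0.
  have D : is_derive x 1 (fun x => P (x, 0)) (dd (1 : R, 0 : R) P (x, 0)).
    by apply: is_derive_fst; exact: smooth_is_derive Qx.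
  have P0 z : `|z| < d -> P (z, 0) = (c z, 0).
    by move=> zd; rewrite /P /= Phi20 //; exact: close.
  have near0 : \forall z \near x, P (z, 0) = (c z, 0).
    have : ball (0 : R) d x by rewrite -ball_normE /= sub0r normrN.
    move=> xb; apply: (near_open (ball_open _ _) xb) => z.
    by rewrite -ball_normE /= sub0r normrN; exact: P0.
  have [_ D1] := near_eq_is_derive near0 D.
  have [_ Dc] := Phi1D _ _ yy (lt_le_trans xd dr1).
  have [_ D2] := is_derive_pair Dc (is_derive_cst (0 : R) x 1).
  by rewrite -D1 D2 P0.
- by rewrite /P /= c0 Phi20 // subrr normr0.
Qed.

End FlowingCurves.

(** * Tangency is preserved *)

Section Tangency.
Context {R : realType}.
Implicit Types E F G : normedModType R.
Local Notation plane := 'rV[R]_2.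
Local Notation spacetime := (plane * R)%type.

Lemma enorm_scale (b a : R) : 0 <= b -> enorm (b *: vec2 (cos a) (sin a)) = b.
Proof.
move=> b0; rewrite /enorm big_ord_recl big_ord1 !mxE /=.
by rewrite !exprMn -mulrDr cos2Dsin2 mulr1 sqrtr_sqr ger0_norm.
Qed.

Lemma is_derive_is_diff F (f : R -> F) (x : R) d :
  is_derive x 1 f d -> is_diff x f (fun v => v *: d).
Proof.
move=> D; apply: DiffDef; first exact/derivable1_diffP.
by rewrite deriv1E // derive1E derive_val.
Qed.

Lemma is_derive_reparam F (f : R -> F) (sigma : R -> R) (s : R) k d :
  is_derive s 1 sigma k -> is_derive (sigma s) 1 f d ->
  is_derive s 1 (fun s => f (sigma s)) (k *: d).
Proof.
move=> /is_derive_is_diff Ds /is_derive_is_diff Df.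
by have := is_derive_comp_diff (1 : R) Ds Df; rewrite scale1r.
Qed.

Lemma is_derive_is_derive_within F (A : set R) (f : R -> F) (t : R) l :
  is_derive t 1 f l -> is_derive_within A f t l.
Proof.
move=> /is_derive_epsP Hd.
apply/cvgrPdist_le => e e0.
have st : {for t, continuous (fun s => s - t)}.
  by apply: cvgB; [exact: cvg_id|exact: cvg_cst].
rewrite /prop_for /continuous_at subrr in st.
have Hd' : \forall s \near t,
   `|f (t + (s - t) *: 1) - f t - (s - t) *: l| <= e * `|s - t| := st _ (Hd e e0).
rewrite near_withinE near_withinE; apply: filterS Hd' => s + ts _.
have s0 : s - t != 0 by rewrite subr_eq0.
rewrite [_ *: 1]mulr1 [t + _]addrC subrK => H.
rewrite -[l](scalerK s0) -scalerBr normrZ normfV.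
by rewrite ler_pdivrMl ?normr_gt0 // [leRHS]mulrC distrC.
Qed.

Lemma derive_unit_dir (N : set spacetime) (g : spacetime -> R) p v :
  open N -> smooth N g -> N p ->
  is_derive p v (unit_dir g) (dd v g p *: normal_dir g p).
Proof.
move=> No gS Np.
apply: is_derive_eq (is_derive_vec2 (is_derive_cosg No gS v Np)
  (is_derive_sing No gS v Np)) _.
rewrite /normal_dir !vec2E scalerDr !scalerA mulrN.
by rewrite [sin _ * _]mulrC [cos _ * _]mulrC.
Qed.

Lemma smooth_tangent_part (N : set spacetime) (g : spacetime -> R)
    (Q : set (R * R)) (P : R * R -> spacetime) :
  open N -> smooth N g -> open Q -> smooth Q P -> (forall q, Q q -> N (P q)) ->
  smooth Q (tangent_part g P).
Proof.
move=> No gS Qo PS PN n.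
have comp (f : spacetime -> R) : smooth N f -> Ck n Q (fun q => f (P q)).
  by move=> fS; apply: (Ck_comp Qo PN (PS n) (fS n)).
have cC := comp _ (smooth_cos No gS).
have sC := comp _ (smooth_sin No gS).
have vC (j : 'I_2) : Ck n Q (fun q => speed P q 0 j).
  have l1 : linear (fun p : spacetime => p.1 0 j : R^o) by move=> k a b; rewrite !mxE.
  have l2 : continuous (fun p : spacetime => p.1 0 j).
    move=> p; apply: (@continuous_comp _ _ _ fst (fun z : plane => z 0 j)).
      exact: cvg_fst.
    exact: coord_continuous.
  exact: (Ck_linear_comp Qo l1 l2 (smooth_dd (1 : R, 0 : R) Qo PS n)).
apply: Ck_add => //.
  exact: (@Ck_scale _ _ _ R _ _ _ Qo cC (vC 0)).
exact: (@Ck_scale _ _ _ R _ _ _ Qo sC (vC 1)).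
Qed.

(** The normal part of the velocity vanishes at time 0 and solves a homogeneous
    linear equation at the times in [0, T[, hence it vanishes there. The
    tangential part equals 1 at the base point and stays positive nearby. *)
Lemma curves_stay_tangent (T : \bar R) (N : set spacetime) (g : spacetime -> R)
    (d : R) (P : R * R -> spacetime) :
  open N -> smooth N g ->
  (forall p, N p -> 0 <= p.2 -> (p.2%:E < T)%E ->
    dd (0 : plane, 1 : R) g p = dd e_x (dd e_x g) p * cos (g p) ^+ 2
    + 2 * dd e_x (dd e_y g) p * sin (g p) * cos (g p)
    + dd e_y (dd e_y g) p * sin (g p) ^+ 2) ->
  0 < d -> smooth (flow_box (0 : R) d) P ->
  (forall q, flow_box (0 : R) d q -> [/\ N (P q),
    dd (0 : R, 1 : R) P q = (curv g (P q) *: normal_dir g (P q), 1) &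
    (P q).2 = q.2]) ->
  (forall x, `|x| < d -> speed P (x, 0) = unit_dir g (P (x, 0))) ->
  exists2 d', 0 < d' <= d & forall q, flow_box (0 : R) d' q ->
    0 < tangent_part g P q /\
    (0 <= q.2 -> (q.2%:E < T)%E -> normal_part g P q = 0).
Proof.
move=> No gS heat d0 PS PQ Pinit.
have Qo := @open_flow_box _ R 0 d.
have PN q : flow_box (0 : R) d q -> N (P q) by move=> /PQ[].
have Pt q : flow_box (0 : R) d q ->
  dd (0 : R, 1 : R) P q = (curv g (P q) *: normal_dir g (P q), 1).
  by move=> /PQ[].
have Pc q : flow_box (0 : R) d q -> (P q).2 = q.2 by move=> /PQ[].
have Q0 : flow_box (0 : R) d (0, 0) by split; rewrite /= ?subrr normr0.
have kS := smooth_curv No gS.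
pose nu q := - sin (g (P q)) * dd e_x (curv g) (P q)
  + cos (g (P q)) * dd e_y (curv g) (P q).
have comp (f : spacetime -> R) : smooth N f ->
    Ck 0 (flow_box (0 : R) d) (fun q => f (P q)).
  by move=> fS; apply: (Ck_comp Qo PN (PS 0%N) (fS 0%N)).
have cC := comp _ (smooth_cos No gS).
have sC := comp _ (smooth_sin No gS).
have xC := comp _ (smooth_dd e_x No kS).
have yC := comp _ (smooth_dd e_y No kS).
have nuC : {for (0, 0), continuous nu}.
  apply: (@Ck_continuous _ 0 _ _ _ _ _ _ Q0); apply: Ck_add => //.
    exact: (@Ck_scale _ _ _ R _ _ _ Qo (Ck_opp Qo sC) xC).
  exact: (@Ck_scale _ _ _ R _ _ _ Qo cC yC).
have bC : {for (0, 0), continuous (tangent_part g P)}.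
  exact: (Ck_continuous (smooth_tangent_part No gS Qo PS PN 0%N) Q0).
have b0 : tangent_part g P (0, 0) = 1.
  rewrite /tangent_part Pinit ?normr0 // !mxE /= -[RHS](cos2Dsin2 (g (P (0, 0)))).
  by rewrite !expr2.
have nb : \forall q \near (0 : R, 0 : R), 0 < tangent_part g P q.
  by move/cvgr_gt : bC; apply; rewrite b0.
have nn : \forall q \near (0 : R, 0 : R), `|nu q| <= `|nu (0, 0)| + 1.
  move/cvgrPdist_le : nuC => /(_ 1 ltr01); apply: filterS => q H.
  rewrite -[nu q](subrK (nu (0, 0))) (le_trans (ler_normD _ _)) //.
  by rewrite addrC lerD2l distrC.
have : \forall q \near (0 : R, 0 : R), 0 < tangent_part g P q /\
    `|nu q| <= `|nu (0, 0)| + 1 by exact: filterI.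
move=> /nbhs_normP[e /= e0 He].
pose L := `|nu (0, 0)| + 1.
have L0 : 0 <= L by rewrite addr_ge0.
exists (Num.min d e); first by rewrite lt_min d0 e0 ge_min lexx.
have sub q : flow_box (0 : R) (Num.min d e) q ->
    flow_box (0 : R) d q /\ 0 < tangent_part g P q /\ `|nu q| <= L.
  move=> [/= H1 H2]; rewrite !lt_min in H1 H2.
  have /andP[H11 H12] := H1; have /andP[H21 H22] := H2.
  split; first by split.
  by apply: He; rewrite /= prod_normE /= gt_max H12 sub0r normrN.
move=> [x t] Qq; have [Qd [bq _]] := sub _ Qq; split=> // /= t0 tT.
have Qs (s : R) : 0 <= s <= t -> flow_box (0 : R) (Num.min d e) (x, s).
  move=> /andP[s0 st]; have [H1 H2] := Qq; split=> //=.
  by rewrite (le_lt_trans _ H2) //= !ger0_norm.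
have tt : 0 <= t <= t by rewrite t0 lexx.
suff : `|normal_part g P (x, t)| <= 2 * (0 + 0 * t) * expR (2 * L * t).
  by rewrite mul0r addr0 mulr0 mul0r normr_le0 => /eqP.
apply: (@gronwall _ _ (fun s => normal_part g P (x, s))
  (fun s => nu (x, s) * normal_part g P (x, s)) L 0 0 t L0 (lexx _) t0 _ _ _ t tt).
- move=> s st; have [Qsd _] := sub _ (Qs _ st).
  have /andP[s0 s_t] := st.
  have P2 := Pc _ Qsd.
  have h : dd (curv g (P (x, s)) *: normal_dir g (P (x, s)), 1 : R) g (P (x, s)) =
     dd (unit_dir g (P (x, s)), 0 : R) (curv g) (P (x, s)).
    apply: (angle_along_flow No gS (PN _ Qsd)); apply: heat.
    + exact: PN.
    + by rewrite P2.
    + by rewrite P2 /=; apply: le_lt_trans tT; rewrite lee_fin.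
  have := derive_normal_part No gS Qo PS PN Pt Pc Qsd h.
  move=> /is_derive_snd; rewrite (derive_space _ No kS (PN _ Qsd)) !mxE /=.
  by [].
- move=> s /Qs/sub[_ [_ Hn]]; rewrite addr0 normrM ler_wpM2r //.
- have xd : `|x| < d by have [H1 _] := Qd; rewrite /= sub0r normrN in H1.
  rewrite /normal_part Pinit // !mxE /=.
  by rewrite mulNr [sin _ * _]mulrC addNr normr0.
Qed.

End Tangency.

(** * Geometry of the tangent curves *)

Section TangentCurves.
Context {R : realType}.
Implicit Types E F G : normedModType R.
Local Notation plane := 'rV[R]_2.
Local Notation spacetime := (plane * R)%type.

Variables (N : set spacetime) (g : spacetime -> R) (d : R).
Variable (P : R * R -> spacetime).
Hypotheses (No : open N) (gS : smooth N g).
Hypotheses (PS : smooth (flow_box (0 : R) d) P).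
Hypothesis PN : forall q, flow_box (0 : R) d q -> N (P q).
Hypothesis P_clock : forall q, flow_box (0 : R) d q -> (P q).2 = q.2.

Let Qo := @open_flow_box R R 0 d.

Lemma is_derive_curve (x t : R) : flow_box (0 : R) d (x, t) ->
  is_derive x 1 (fun x => (P (x, t)).1) (speed P (x, t)).
Proof.
move=> Qq.
have D : is_derive x 1 (fun x => P (x, t)) (dd (1 : R, 0 : R) P (x, t)).
  by apply: is_derive_fst; exact: smooth_is_derive Qq.
have fc : continuous (fst : spacetime -> plane) by move=> p; exact: cvg_fst.
exact: (is_derive_linear_comp (fun _ _ _ => erefl) fc D).
Qed.

Variable t : R.
Hypothesis tangent_t : forall x, flow_box (0 : R) d (x, t) ->
  0 < tangent_part g P (x, t) /\ normal_part g P (x, t) = 0.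

Lemma speed_tangent x : flow_box (0 : R) d (x, t) ->
  speed P (x, t) = tangent_part g P (x, t) *: unit_dir g (P (x, t)).
Proof.
by move=> /tangent_t[_ n0]; rewrite (speedE g P) n0 scale0r addr0.
Qed.

Lemma enorm_speed x : flow_box (0 : R) d (x, t) ->
  enorm (speed P (x, t)) = tangent_part g P (x, t).
Proof.
move=> Qx; rewrite speed_tangent // enorm_scale // ltW //.
by have [] := tangent_t Qx.
Qed.

(** The unit tangent is the direction field along the curve, and its derivative
    is (derivative of the angle) times the normal. *)
Lemma curvature_vectorE x : flow_box (0 : R) d (x, t) ->
  curvature_vector (fun x => (P (x, t)).1) x =
  curv g (P (x, t)) *: normal_dir g (P (x, t)).
Proof.
move=> Qx; have Np := PN Qx.
have d1 x' : flow_box (0 : R) d (x', t) ->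
    derive1 (fun x => (P (x, t)).1) x' = speed P (x', t).
  by move=> Qx'; rewrite derive1E; have [_ ->] := is_derive_curve Qx'.
have [b0 _] := tangent_t Qx.
rewrite /curvature_vector d1 // enorm_speed //.
have near_x : \forall x' \near x,
    unit_dir g (P (x', t)) = unit_tangent (fun x => (P (x, t)).1) x'.
  have xc : {for x, continuous (fun x' : R => (x', t))}.
    by apply: (@continuous_pair _ _ _ id (fun=> t)); [exact: cvg_id|exact: cst_continuous].
  have nQ : \forall x' \near x, flow_box (0 : R) d (x', t).
    apply: (xc (flow_box (0 : R) d)); exact: open_nbhs_nbhs.
  apply: filterS nQ => x' Qx'; have [b0' _] := tangent_t Qx'.
  rewrite /unit_tangent d1 // enorm_speed // speed_tangent // scalerA.
  by rewrite mulVf ?gt_eqF // scale1r.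
have D : is_derive x 1 (fun x => unit_dir g (P (x, t)))
    (dd (speed P (x, t), 0 : R) g (P (x, t)) *: normal_dir g (P (x, t))).
  apply: (@is_derive_fst _ _ _ _ (fun q => unit_dir g (P q))).
  have := smooth_chain (1 : R, 0 : R) Qo PS Qx No (smooth_unit_dir No gS) Np.
  rewrite (derive_space_P Qo PS P_clock Qx).
  by rewrite (is_derive_dd (derive_unit_dir _ No gS Np)).
have [_ D'] := near_eq_is_derive near_x D.
rewrite derive1E D' scalerA; congr (_ *: _).
rewrite (derive_space _ No gS Np) speed_tangent // !mxE /= /curv.
by rewrite /GRing.scale /=; field; rewrite gt_eqF.
Qed.

(** Reparametrised by arclength, the curve has velocity equal to the direction
    field. *)
Lemma tangent_integral_curve (Omega : set plane) (X : plane -> plane) (d1 : R) :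
  0 < d1 -> d1 < d -> `|t| < d ->
  (forall x, flow_box (0 : R) d (x, t) -> Omega (P (x, t)).1 /\
     X (P (x, t)).1 = unit_dir g (P (x, t))) ->
  integral_curve Omega X
    ((fun x => (P (x, t)).1) @` [set x | ((- d1)%:E < x%:E < d1%:E)%E]).
Proof.
move=> d10 d1d td OX.
have box (x : R) : - d1 <= x <= d1 -> flow_box (0 : R) d (x, t).
  move=> /andP[x1 x2]; split=> //=; rewrite sub0r normrN ltr_norml.
  by apply/andP; split; lra.
pose b x := tangent_part g P (x, t).
have bP x : - d1 <= x <= d1 -> {for x, continuous b} /\ 0 < b x.
  move=> /box Qx; split; last by have [] := tangent_t Qx.
  have xc : {for x, continuous (fun x' : R => (x', t))}.
    by apply: (@continuous_pair _ _ _ id (fun=> t)); [exact: cvg_id|exact: cst_continuous].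
  apply: (@continuous_comp _ _ _ (fun x' : R => (x', t)) (tangent_part g P) _ xc).
  exact: (Ck_continuous (smooth_tangent_part No gS Qo PS PN 0%N) Qx).
have [s0 [s1 [sigma [s01 sD sS]]]] := arclength_parameter d10 bP.
exists [set s | (s0%:E < s%:E < s1%:E)%E], (fun s => (P (sigma s, t)).1); split.
- by exists s0%:E, s1%:E; rewrite lte_fin.
- move=> s /=; rewrite !lte_fin => /sD[/andP[x1 x2] sDs].
  have Qx : flow_box (0 : R) d (sigma s, t) by apply: box; rewrite !ltW.
  have [Ox ->] := OX _ Qx; split=> //.
  have := is_derive_reparam sDs (is_derive_curve Qx).
  rewrite speed_tangent // scalerA mulVf ?scale1r //.
  by rewrite gt_eqF //; have [] := tangent_t Qx.
- apply/seteqP; split=> z /=.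
  + move=> [x]; rewrite !lte_fin => /sS[s ss <-] <-.
    by exists s; rewrite ?lte_fin.
  + move=> [s]; rewrite !lte_fin => /sD[ss _] <-.
    by exists (sigma s); rewrite ?lte_fin.
Qed.

End TangentCurves.

(** * The theorem *)

Theorem theorem4p1 (R : realType) (T : \bar R) (W : set ('rV[R]_2 * R))
    (theta : 'rV[R]_2 * R -> angle R)
    (hW : rel_open T W)
    (htheta : smooth_angle W theta)
    (heq : angle_equation W theta)
    (y : 'rV[R]_2) (hy : slice W 0 y) :
  exists (Ty : R) (L : R -> set 'rV[R]_2),
    [/\ (0 < Ty) /\ (Ty%:E <= T)%E,
        forall t, t \in `[0, Ty[ ->
          integral_curve (slice W t) (V1 theta t) (L t),
        L 0 y &
        smooth_mcf Ty L].
Proof.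
have [N [g [No Ny gS gl NW]]] := local_smooth_lift hW htheta hy.
have T0 : (0 < T)%E.
  by have [V [_ WV]] := hW; move: hy; rewrite /slice /= WV => -[_ []].
have heat p Np p0 pT := @lift_heat_equation R T W theta N g p heq No gS gl NW Np p0 pT.
have [d [P [d0 [PS PQ Pinit P0]]]] := flowing_curves No gS Ny.
have [d' /andP[d'0 d'd] tan] := curves_stay_tangent No gS heat d0 PS PQ Pinit.
have sub q : flow_box (0 : R) d' q -> flow_box (0 : R) d q.
  by move=> [q1 q2]; split; exact: lt_le_trans d'd.
have PS' : smooth (flow_box (0 : R) d') P by move=> n; exact: (Ck_sub sub (PS n)).
have PN q : flow_box (0 : R) d' q -> N (P q) by move=> /sub/PQ[].
have Pc q : flow_box (0 : R) d' q -> (P q).2 = q.2 by move=> /sub/PQ[].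
have Pt q : flow_box (0 : R) d' q ->
  dd (0 : R, 1 : R) P q = (curv g (P q) *: normal_dir g (P q), 1).
  by move=> /sub/PQ[].
(* A closed interval inside the box, so that the curves extend smoothly beyond
   their ends. *)
pose d1 := d' / 2.
have d10 : 0 < d1 by rewrite divr_gt0.
have d1d : d1 < d' by rewrite gtr_pMr // invf_lt1 // ltr1n.
have [Ty [Ty0 TyT Tyd]] : exists Ty, [/\ 0 < Ty, (Ty%:E <= T)%E & Ty <= d1].
  case: T T0 {hW NW heat tan} => [u| |] //.
    rewrite lte_fin => u0; exists (Num.min u d1).
    by rewrite lt_min u0 d10 lee_fin !ge_min !lexx orbT.
  by move=> _; exists d1; rewrite leey d10.
pose J : set R := [set x | ((- d1)%:E < x%:E < d1%:E)%E].
pose F (q : R * R) := (P q).1.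
have box x t : J x -> 0 <= t < Ty -> flow_box (0 : R) d' (x, t).
  rewrite /J /= !lte_fin => /andP[x1 x2] /andP[t0 tT]; split => /=.
    by rewrite sub0r normrN ltr_norml; apply/andP; split; lra.
  by rewrite ger0_norm //; lra.
have tanT t : 0 <= t < Ty -> forall x, flow_box (0 : R) d' (x, t) ->
    0 < tangent_part g P (x, t) /\ normal_part g P (x, t) = 0.
  move=> /andP[t0 tT] x /tan[b0 n0]; split=> //; apply: n0 => //=.
  by apply: lt_le_trans TyT; rewrite lte_fin.
have J0 : J 0 by rewrite /J /= !lte_fin oppr_lt0 d10.
exists Ty, (fun t => (fun x => F (x, t)) @` J); split.
- by split.
- move=> t; rewrite in_itv /= => tT; have /andP[t0 t1] := tT.
  have td : `|t| < d' by rewrite ger0_norm //; lra.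
  apply: (tangent_integral_curve No gS PS' PN (tanT _ tT) d10 d1d td).
  move=> x Qx; have PE : P (x, t) = (F (x, t), t).
    by rewrite [LHS]surjective_pairing (Pc _ Qx).
  have Wq : W (F (x, t), t).
    rewrite -PE; apply: NW; first exact: PN.
      by rewrite Pc.
    by rewrite Pc //=; apply: lt_le_trans TyT; rewrite lte_fin.
  split; first exact: Wq.
  have [_ _ /(_ _ Wq) E] := gl; have := PN _ Qx; rewrite PE => /E Eg.
  by rewrite /V1 -/(F (x, t)) Eg cos_to_angle sin_to_angle.
- by exists 0 => //; rewrite /F P0.
- exists J, F; split.
  + by exists (- d1)%:E, d1%:E; split=> //; rewrite lte_fin; lra.
  + move=> [x t] [/= Jx]; rewrite in_itv /= => tT.
    exists (flow_box (0 : R) d'), F; split=> //; first exact: open_flow_box.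
      exact: box.
    have Qo := @open_flow_box _ R 0 d'.
    apply: (smooth_smooth_open Qo) => n.
    apply: (Ck_linear_comp Qo _ _ (PS' n)) => //.
    by move=> p; exact: cvg_fst.
  + move=> t; rewrite in_itv /= => tT; split=> //.
    * move=> x Jx; have Qx := box _ _ Jx tT.
      rewrite derive1E; have [_ ->] := is_derive_curve PS' Qx.
      apply/eqP => s0; have := enorm_speed (tanT _ tT) Qx.
      have [b0 _] := tanT _ tT _ Qx.
      rewrite s0 -[X in enorm X](scale0r (vec2 (cos 0) (sin 0))) enorm_scale // => b0'.
      by rewrite -b0' ltxx in b0.
    * move=> x Jx; have Qx := box _ _ Jx tT.
      apply: is_derive_is_derive_within.
      rewrite (curvature_vectorE No gS PS' PN Pc (tanT _ tT) Qx).
      have Qo := @open_flow_box _ R 0 d'.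
      have D := is_derive_snd (smooth_is_derive (0 : R, 1 : R) Qo PS' Qx).
      rewrite (Pt _ Qx) in D.
      have fc : continuous (fst : 'rV[R]_2 * R -> 'rV[R]_2).
        by move=> p; exact: cvg_fst.
      exact: (is_derive_linear_comp (fun _ _ _ => erefl) fc D).
Qed.
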